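(* For all $z\in\mathbb{C}\setminus\{0\}$ with $|\arg z|<\pi$, $$\frac{W(z)}{z}=\frac{1}{\pi}\int_0^\pi\frac{v^2+(1-v\cot v)^2}{z+v\csc(v)\,e^{-v\cot v}}\,dv .$$
   Context: $W$ denotes the principal branch of the Lambert $W$ function: the unique holomorphic function on $\mathbb{C}\setminus(-\infty,-1/e]$ with $W(z)e^{W(z)}=z$ and $W(0)=0$. $|\arg z|<\pi$ means $z\in\mathbb{C}\setminus(-\infty,0]$. *)

(* Defs.v *)
From Stdlib Require Import Reals.
From Coquelicot Require Import Coquelicot.

Open Scope R_scope.

Definition Cexp (z : C) : C :=
  (exp (Re z) * cos (Im z), exp (Re z) * sin (Im z)).

(* The complement in C of the real half-line ]-oo, a]. For a = 0 it is the
   set of nonzero z with |arg z| < PI. *)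
Definition slit_plane (a : R) (z : C) : Prop :=
  ~ (Im z = 0 /\ Re z <= a).

(* W is total, but its values outside the domain of the principal branch are
   left arbitrary. ex_derive is differentiability over the normed field C,
   i.e. complex differentiability. *)
Definition is_principal_LambertW (W : C -> C) : Prop :=
  (forall z : C, slit_plane (-1 / exp 1) z ->
     ex_derive (K := C_AbsRing) (V := C_NormedModule) W z) /\
  (forall z : C, slit_plane (-1 / exp 1) z -> (W z * Cexp (W z))%C = z) /\
  W (RtoC 0) = RtoC 0.

Definition cot (v : R) : R := cos v / sin v.
Definition csc (v : R) : R := / sin v.

(* At v = 0 and v = PI, where sin v = 0, this takes a junk value, which does
   not affect Riemann integrability on [0, PI] or the integral. *)
Definition LambertW_integrand (z : C) (v : R) : C :=
  (RtoC (v ^ 2 + (1 - v * cot v) ^ 2)%R /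
   (z + RtoC (v * csc v * exp (- (v * cot v)))%R))%C.

(* Main.v *)
Require Import Defs.
From Stdlib Require Import Reals.
From Coquelicot Require Import Coquelicot.
From Stdlib Require Import Lra Classical ClassicalEpsilon.

(** Write c for a point of the plane and f(c) = c e^c. The curve

      c(v) = - v cot v + i v,   - PI < v < PI,

    satisfies f(c(v)) = - v csc v e^(- v cot v), so f sends it to the two sides
    of the branch cut: it is the boundary of the range of the principal branch,
    traversed from the lower right, around -1 at v = 0, to the upper right.
    The numerator of the integrand is the imaginary part of (1 + c(v)) c'(v),
    and f(c(v)) is real and even in v; hence - 2 i times the integral from 0 to
    PI is the integral along the whole curve of the kernel

      (1 + c) / (f(c) - z).

    To the right of the curve this kernel has exactly one pole, at w = W(z),
    where its residue is (1 + w) / f'(w) = e^(-w) = W(z) / z, and it decays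
    like e^(-c) as Re c grows. The residue theorem therefore gives the formula.

    The proof of this instance of the residue theorem is elementary. Cut the
    curve at heights d < |v| < V and close it with two vertical segments. This
    closed contour is contracted onto w by the homotheties of centre w and ratio
    s in ]0, 1]. With c = w + s u, the integral of the kernel over the shrunken
    contour is the integral of k(s u) du / u, where k(h) is h times the kernel
    at w + h; its derivative in s is the integral of an exact form, which
    vanishes on a closed contour ([is_derive_contracted_integral]). As k extends
    continuously to 0 with value e^(-w), the limit s -> 0 leaves e^(-w) times the
    integral of du / u, which a logarithm evaluates to - 2 i PI
    ([winding_of_contour]). Letting d -> 0 and V -> PI removes the segments.

    Two facts about f make this possible. The contraction never meets another
    solution of f(c) = z ([segment_no_other_preimage]): f is injective on the
    strip 0 < Im c < PI because Im (1 + 1/c) < 0 there, where 1 + 1/c is the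
    derivative of c + log c; and in the opposite half of the strip the segment
    stays to the right of the curve, which is convex, so that Im f(c) does not
    have the sign of Im z there. Also, W(z) does lie to the right of the curve
    ([LambertW_in_region]), since the continuous path s |-> W(s z) starts at 0,
    and could leave this region only through points of the curve, where f takes
    negative values. *)

(** * Continuity and differentiation of complex-valued functions *)

Local Notation Ccont f x := (continuous (U := C_UniformSpace) f x).
Local Notation Cderiv p t d :=
  (is_derive (K := R_AbsRing) (V := C_R_NormedModule) p t d).
Local Notation is_CInt f a b l := (is_RInt (V := C_R_NormedModule) f a b l).
Local Notation ex_CInt f a b := (ex_RInt (V := C_R_NormedModule) f a b).
Local Notation CInt f a b := (RInt (V := C_R_CompleteNormedModule) f a b).

Lemma continuous_C_components {T : UniformSpace} (f : T -> C) (x : T) :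
  Ccont f x <->
  continuous (fun t => fst (f t)) x /\ continuous (fun t => snd (f t)) x.
Proof.
  split.
  - intros H; split.
    + apply (continuous_comp f fst); [exact H|].
      destruct (f x); apply continuous_fst.
    + apply (continuous_comp f snd); [exact H|].
      destruct (f x); apply continuous_snd.
  - intros [H1 H2].
    apply filterlim_ext with (fun t => (fst (f t), snd (f t))).
    { intros t; now destruct (f t). }
    rewrite (surjective_pairing (f x)).
    apply (filterlim_filter_le_2 (G:= filter_prod (locally (fst (f x))) (locally (snd (f x))))).
    + intros P [eps HP]. exists (ball (fst (f x)) eps) (ball (snd (f x)) eps).
      apply locally_ball. apply locally_ball. intros a b Ha Hb. apply HP; split; assumption.
    + apply filterlim_pair; assumption.
Qed.

Lemma continuous_Cplus {T : UniformSpace} (f g : T -> C) (x : T) :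
  Ccont f x -> Ccont g x -> Ccont (fun t => (f t + g t)%C) x.
Proof.
  exact (continuous_plus (V := C_R_NormedModule) f g x).
Qed.

Lemma continuous_Cminus {T : UniformSpace} (f g : T -> C) (x : T) :
  Ccont f x -> Ccont g x -> Ccont (fun t => (f t - g t)%C) x.
Proof.
  exact (continuous_minus (V := C_R_NormedModule) f g x).
Qed.

Lemma continuous_Cmult {T : UniformSpace} (f g : T -> C) (x : T) :
  Ccont f x -> Ccont g x -> Ccont (fun t => (f t * g t)%C) x.
Proof.
  rewrite !continuous_C_components; intros [f1 f2] [g1 g2]; split; simpl.
  - apply (continuous_minus (V := R_NormedModule));
      apply (continuous_mult (K := R_AbsRing)); assumption.
  - apply (continuous_plus (V := R_NormedModule));
      apply (continuous_mult (K := R_AbsRing)); assumption.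
Qed.

Lemma Cnorm2_neq_0 (c : C) : c <> RtoC 0 -> fst c ^ 2 + snd c ^ 2 <> 0.
Proof.
  destruct c as [a b]; simpl; intros H E; apply H.
  assert (a = 0) by nra. assert (b = 0) by nra. now subst.
Qed.

Lemma continuous_Cinv {T : UniformSpace} (f : T -> C) (x : T) :
  Ccont f x -> f x <> RtoC 0 -> Ccont (fun t => (/ f t)%C) x.
Proof.
  intros Hf H0; revert Hf; rewrite !continuous_C_components; intros [f1 f2].
  apply Cnorm2_neq_0 in H0.
  assert (Hi : continuous (fun t => / (fst (f t) ^ 2 + snd (f t) ^ 2)) x).
  { apply (continuous_comp (fun t => fst (f t) ^ 2 + snd (f t) ^ 2) Rinv).
    - apply (continuous_plus (V := R_NormedModule)); simpl;
      repeat apply (continuous_mult (K := R_AbsRing)); try assumption;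
      apply continuous_const.
    - now apply continuous_Rinv. }
  split; simpl.
  - now apply (continuous_mult (K := R_AbsRing)).
  - apply (continuous_mult (K := R_AbsRing)); [|assumption].
    now apply (continuous_opp (V := R_NormedModule)).
Qed.

Lemma continuous_Cdiv {T : UniformSpace} (f g : T -> C) (x : T) :
  Ccont f x -> Ccont g x -> g x <> RtoC 0 -> Ccont (fun t => (f t / g t)%C) x.
Proof.
  intros; apply continuous_Cmult; [assumption|now apply continuous_Cinv].
Qed.

Lemma continuous_Cexp {T : UniformSpace} (f : T -> C) (x : T) :
  Ccont f x -> Ccont (fun t => Cexp (f t)) x.
Proof.
  rewrite !continuous_C_components; intros [f1 f2]; unfold Cexp, Re, Im; simpl.
  split; apply (continuous_mult (K := R_AbsRing)).
  all: try (apply continuous_comp; [assumption|]).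
  1, 3: apply (ex_derive_continuous (K:=R_AbsRing) (V:=R_NormedModule)); auto_derive; trivial.
  apply continuous_cos. apply continuous_sin.
Qed.

Lemma continuous_RtoC {T : UniformSpace} (f : T -> R) (x : T) :
  continuous f x -> Ccont (fun t => RtoC (f t)) x.
Proof.
  intros H; apply continuous_C_components; split; simpl;
    [exact H|apply continuous_const].
Qed.

Lemma is_derive_C_components (p : R -> C) (t : R) (d : C) :
  Cderiv p t d <->
  is_derive (fun s => fst (p s)) t (fst d) /\
  is_derive (fun s => snd (p s)) t (snd d).
Proof.
  split.
  - intros H; split.
    + apply (is_derive_ext (fun s => fst (p s))); [easy|].
      apply (filterdiff_ext_lin _ (fun y : R => fst (scal (V := C_R_NormedModule) y d))); [|easy].
      apply (filterdiff_comp' (U := AbsRing_NormedModule R_AbsRing)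
        (V := C_R_NormedModule) (W := R_NormedModule) p fst t
        (fun y : R => scal (V := C_R_NormedModule) y d) fst H).
      apply filterdiff_linear, is_linear_fst.
    + apply (filterdiff_ext_lin _ (fun y : R => snd (scal (V := C_R_NormedModule) y d))); [|easy].
      apply (filterdiff_comp' (U := AbsRing_NormedModule R_AbsRing)
        (V := C_R_NormedModule) (W := R_NormedModule) p snd t
        (fun y : R => scal (V := C_R_NormedModule) y d) snd H).
      apply filterdiff_linear, is_linear_snd.
  - intros [H1 H2].
    assert (H := filterdiff_comp'_2 (K := R_AbsRing) (T := R_NormedModule)
      (U := R_NormedModule) (V := R_NormedModule) (W := C_R_NormedModule)
      (fun s => fst (p s)) (fun s => snd (p s)) (fun a b => (a, b)) t
      _ _ (fun a b => (a, b)) H1 H2).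
    apply (filterdiff_ext (K := R_AbsRing) (U := R_NormedModule)
      (V := C_R_NormedModule) (fun s => (fst (p s), snd (p s)))).
    { intros s; now destruct (p s). }
    eapply filterdiff_ext_lin.
    + apply H. apply (filterdiff_ext (fun t => t)). now intros []. 
      apply (filterdiff_ext_lin _ (fun t => t)). apply filterdiff_id. now intros [].
    + intros y; now destruct d.
Qed.

Lemma is_derive_Cmult (p q : R -> C) (t : R) (dp dq : C) :
  Cderiv p t dp -> Cderiv q t dq ->
  Cderiv (fun s => (p s * q s)%C) t (dp * q t + p t * dq)%C.
Proof.
  rewrite !is_derive_C_components.
  set (p1 := fun s : R => fst (p s)); set (p2 := fun s : R => snd (p s)).
  set (q1 := fun s : R => fst (q s)); set (q2 := fun s : R => snd (q s)).
  intros [Hp1 Hp2] [Hq1 Hq2].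
  change (is_derive p1 t (fst dp)) in Hp1; change (is_derive p2 t (snd dp)) in Hp2.
  change (is_derive q1 t (fst dq)) in Hq1; change (is_derive q2 t (snd dq)) in Hq2.
  split.
  - change (is_derive (fun s => p1 s * q1 s - p2 s * q2 s) t
      (fst dp * q1 t - snd dp * q2 t + (p1 t * fst dq - p2 t * snd dq))).
    auto_derive; [repeat split; eexists; eassumption|].
    rewrite (is_derive_unique (fun x : R => p1 x) _ _ Hp1),
      (is_derive_unique (fun x : R => p2 x) _ _ Hp2),
      (is_derive_unique (fun x : R => q1 x) _ _ Hq1),
      (is_derive_unique (fun x : R => q2 x) _ _ Hq2); ring.
  - change (is_derive (fun s => p1 s * q2 s + p2 s * q1 s) t
      (fst dp * q2 t + snd dp * q1 t + (p1 t * snd dq + p2 t * fst dq))).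
    auto_derive; [repeat split; eexists; eassumption|].
    rewrite (is_derive_unique (fun x : R => p1 x) _ _ Hp1),
      (is_derive_unique (fun x : R => p2 x) _ _ Hp2),
      (is_derive_unique (fun x : R => q1 x) _ _ Hq1),
      (is_derive_unique (fun x : R => q2 x) _ _ Hq2); ring.
Qed.

Lemma is_derive_Cinv (p : R -> C) (t : R) (dp : C) :
  Cderiv p t dp -> p t <> RtoC 0 ->
  Cderiv (fun s => (/ p s)%C) t (- dp / (p t * p t))%C.
Proof.
  intros Hp H0.
  assert (Hd : (- dp / (p t * p t) = - dp * / p t * / p t)%C) by (now field).
  rewrite Hd; clear Hd; revert Hp; apply Cnorm2_neq_0 in H0; revert H0.
  rewrite !is_derive_C_components.
  set (p1 := fun s : R => fst (p s)); set (p2 := fun s : R => snd (p s)).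
  pose (q := (p1 t / (p1 t ^ 2 + p2 t ^ 2), - p2 t / (p1 t ^ 2 + p2 t ^ 2)) : C).
  change (p1 t ^ 2 + p2 t ^ 2 <> 0 ->
    is_derive p1 t (fst dp) /\ is_derive p2 t (snd dp) ->
    is_derive (fun s => p1 s / (p1 s ^ 2 + p2 s ^ 2)) t (fst (- dp * q * q)%C) /\
    is_derive (fun s => - p2 s / (p1 s ^ 2 + p2 s ^ 2)) t (snd (- dp * q * q)%C)).
  intros H0 [Hp1 Hp2].
  split; auto_derive.
  1, 3: repeat split; try (eexists; eassumption); exact H0.
  all: rewrite (is_derive_unique (fun x : R => p1 x) _ _ Hp1),
      (is_derive_unique (fun x : R => p2 x) _ _ Hp2);
    simpl; field; contradict H0; rewrite <- H0; ring.
Qed.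

Lemma is_derive_Cexp (p : R -> C) (t : R) (dp : C) :
  Cderiv p t dp -> Cderiv (fun s => Cexp (p s)) t (dp * Cexp (p t))%C.
Proof.
  rewrite !is_derive_C_components.
  set (p1 := fun s : R => fst (p s)); set (p2 := fun s : R => snd (p s)).
  intros [Hp1 Hp2].
  change (is_derive p1 t (fst dp)) in Hp1; change (is_derive p2 t (snd dp)) in Hp2.
  split.
  - change (is_derive (fun s => exp (p1 s) * cos (p2 s)) t
      (fst dp * (exp (p1 t) * cos (p2 t)) - snd dp * (exp (p1 t) * sin (p2 t)))).
    auto_derive; [repeat split; eexists; eassumption|].
    rewrite (is_derive_unique (fun x : R => p1 x) _ _ Hp1),
      (is_derive_unique (fun x : R => p2 x) _ _ Hp2); ring.
  - change (is_derive (fun s => exp (p1 s) * sin (p2 s)) t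
      (fst dp * (exp (p1 t) * sin (p2 t)) + snd dp * (exp (p1 t) * cos (p2 t)))).
    auto_derive; [repeat split; eexists; eassumption|].
    rewrite (is_derive_unique (fun x : R => p1 x) _ _ Hp1),
      (is_derive_unique (fun x : R => p2 x) _ _ Hp2); ring.
Qed.

Lemma is_derive_Cplus (p q : R -> C) (t : R) (dp dq : C) :
  Cderiv p t dp -> Cderiv q t dq ->
  Cderiv (fun s => (p s + q s)%C) t (dp + dq)%C.
Proof.
  exact (is_derive_plus (V := C_R_NormedModule) p q t dp dq).
Qed.
Lemma is_derive_Cconst (c : C) (t : R) : Cderiv (fun _ => c) t (RtoC 0).
Proof.
  exact (is_derive_const (V := C_R_NormedModule) c t).
Qed.

Lemma is_derive_RtoC (s : R) : Cderiv RtoC s (RtoC 1).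
Proof.
  exact (proj2 (is_derive_C_components RtoC s (RtoC 1))
    (conj (is_derive_id s) (is_derive_const (V := R_NormedModule) 0 s))).
Qed.

(** * Integrals depending on a parameter *)

(** Compactness of the segment, in the form of the tube lemma: it is what makes
    hypotheses local in both variables uniform in the variable of integration. *)
Lemma locally_forall_segment (P : R * R -> Prop) (s a b : R) :
  (forall t, a <= t <= b -> locally (s, t) P) ->
  locally s (fun r => forall t, a <= t <= b -> P (r, t)).
Proof.
  intros H.
  assert (Hd : forall t, exists d : posreal,
    a <= t <= b -> forall r u, Rabs (r - s) < d -> Rabs (u - t) < d -> P (r, u)).
  { intros t; destruct (classic (a <= t <= b)) as [Ht|Ht].
    - destruct (H t Ht) as [d Hd]; exists d; intros _ r u Hr Hu.
      apply Hd; split; assumption.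
    - exists (mkposreal 1 Rlt_0_1); intros Ht'; contradiction. }
  pose (delta t := proj1_sig (constructive_indefinite_description _ (Hd t))).
  assert (Hdelta := fun t => proj2_sig (constructive_indefinite_description _ (Hd t))).
  fold delta in Hdelta; change (forall t, a <= t <= b -> forall r u,
    Rabs (r - s) < delta t -> Rabs (u - t) < delta t -> P (r, u)) in Hdelta.
  destruct (compactness_value_1d a b delta) as [d Hcov].
  exists d; intros r Hr t Ht; apply NNPP; intros HP; apply (Hcov t Ht).
  intros [u [Hu [Htu Hle]]]; apply HP, (Hdelta u Hu); [|exact Htu].
  eapply Rlt_le_trans; [exact Hr|exact Hle].
Qed.

Lemma is_CInt_components (f : R -> C) (a b : R) (l : C) :
  is_CInt f a b l <->
  is_RInt (fun t => fst (f t)) a b (fst l) /\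
  is_RInt (fun t => snd (f t)) a b (snd l).
Proof.
  split.
  - intros H; split.
    + exact (is_RInt_fct_extend_fst (U := R_NormedModule) (V := R_NormedModule) f a b l H).
    + exact (is_RInt_fct_extend_snd (U := R_NormedModule) (V := R_NormedModule) f a b l H).
  - intros [H1 H2]; destruct l as [l1 l2].
    exact (is_RInt_fct_extend_pair (U := R_NormedModule) (V := R_NormedModule) f a b l1 l2 H1 H2).
Qed.

Lemma ex_CInt_continuous (f : R -> C) (a b : R) : a <= b ->
  (forall t, a <= t <= b -> Ccont f t) -> ex_CInt f a b.
Proof.
  intros Hab H; apply (ex_RInt_continuous (V := C_R_CompleteNormedModule)).
  rewrite Rmin_left, Rmax_right by assumption; exact H.
Qed.

Lemma CInt_components (f : R -> C) (a b : R) : ex_CInt f a b ->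
  CInt f a b = (RInt (fun t => fst (f t)) a b, RInt (fun t => snd (f t)) a b).
Proof.
  intros H; apply (RInt_correct (V := C_R_CompleteNormedModule)) in H.
  apply is_CInt_components in H; destruct H as [H1 H2].
  apply injective_projections; symmetry; apply is_RInt_unique; assumption.
Qed.

Lemma is_CInt_Cmult_l (k : C) (f : R -> C) (a b : R) (l : C) :
  is_CInt f a b l -> is_CInt (fun t => (k * f t)%C) a b (k * l)%C.
Proof.
  intros H; apply is_CInt_components in H; destruct H as [H1 H2].
  apply is_CInt_components; split; simpl.
  - apply (is_RInt_minus (V := R_NormedModule));
      apply (is_RInt_scal (V := R_NormedModule)); assumption.
  - apply (is_RInt_plus (V := R_NormedModule));
      apply (is_RInt_scal (V := R_NormedModule)); assumption.
Qed.

Lemma continuous_slice {U : UniformSpace} (f : R * R -> U) (s t : R) :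
  continuous f (s, t) -> continuous (fun v => f (s, v)) t.
Proof.
  intros H; apply (continuous_comp (fun v => (s, v)) f); [|exact H].
  intros P [d Hd]; exists d; intros v Hv; apply Hd; split; [apply ball_center|exact Hv].
Qed.

Lemma is_derive_RInt_param_jointly (f df : R -> R -> R) (a b s : R) : a <= b ->
  (forall t, a <= t <= b -> locally (s, t) (fun q : R * R =>
     is_derive (fun r => f r (snd q)) (fst q) (df (fst q) (snd q)))) ->
  (forall t, a <= t <= b ->
     continuous (fun q : R * R => df (fst q) (snd q)) (s, t)) ->
  locally s (fun r => ex_RInt (f r) a b) ->
  is_derive (fun r => RInt (f r) a b) s (RInt (df s) a b).
Proof.
  intros Hab Hder Hcont Hex.
  replace (RInt (df s) a b) with (RInt (fun t => Derive (fun u => f u t) s) a b).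
  2:{ apply RInt_ext; intros t; rewrite Rmin_left, Rmax_right by assumption.
      intros Ht; apply is_derive_unique.
      apply (locally_singleton _ _ (Hder t ltac:(lra))). }
  apply is_derive_RInt_param; rewrite ?Rmin_left, ?Rmax_right by assumption.
  - apply (filter_imp (fun r => forall t, a <= t <= b -> is_derive (fun r => f r t) r (df r t))).
    + intros r Hr t Ht; exists (df r t); now apply Hr.
    + apply (locally_forall_segment (fun q : R * R =>
       is_derive (fun r => f r (snd q)) (fst q) (df (fst q) (snd q))) s a b Hder).
  - intros t Ht. apply continuity_2d_pt_filterlim.
    apply filterlim_ext_loc with (fun q : R * R => df (fst q) (snd q)).
    + apply (filter_imp (fun q : R * R =>
       is_derive (fun r => f r (snd q)) (fst q) (df (fst q) (snd q)))); [|now apply Hder].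
      intros q Hq; symmetry; now apply is_derive_unique.
    + replace (Derive (fun z => f z t) s) with (df s t); [now apply Hcont|].
      symmetry; exact (is_derive_unique _ _ _ (locally_singleton _ _ (Hder t Ht))).
  - exact Hex.
Qed.

(** The hypotheses are local around the compact segment {s} x [a, b], because the
    integrands below are only differentiable where the kernel has no pole. *)
Lemma is_derive_CInt_param (f df : R * R -> C) (a b s : R) : a <= b ->
  (forall t, a <= t <= b -> locally (s, t) (fun q : R * R =>
     Cderiv (fun r => f (r, snd q)) (fst q) (df q))) ->
  (forall t, a <= t <= b -> Ccont df (s, t)) ->
  (forall t, a <= t <= b -> locally (s, t) (fun q => Ccont f q)) ->
  Cderiv (fun r => CInt (fun t => f (r, t)) a b) s (CInt (fun t => df (s, t)) a b).
Proof.
  intros Hab Hder Hdf Hf.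
  assert (Hex : locally s (fun r => ex_CInt (fun t => f (r, t)) a b)).
  { apply (filter_imp (fun r => forall t, a <= t <= b -> Ccont f (r, t))).
    - intros r Hr; apply ex_CInt_continuous; [assumption|].
      intros t Ht; now apply continuous_slice, Hr.
    - now apply locally_forall_segment. }
  assert (Hexd : ex_CInt (fun t => df (s, t)) a b).
  { apply ex_CInt_continuous; [assumption|].
    intros t Ht; now apply (continuous_slice df), Hdf. }
  rewrite (CInt_components _ _ _ Hexd).
  apply (is_derive_ext_loc (V := C_R_NormedModule)) with (fun r =>
    (RInt (fun t => fst (f (r, t))) a b, RInt (fun t => snd (f (r, t))) a b)).
  { apply (filter_imp _ _ (fun r Hr => eq_sym (CInt_components _ a b Hr)) Hex). }
  apply is_derive_C_components; split; simpl;
    [apply (is_derive_RInt_param_jointly (fun r t => fst (f (r, t))) (fun r t => fst (df (r, t))))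
    |apply (is_derive_RInt_param_jointly (fun r t => snd (f (r, t))) (fun r t => snd (df (r, t))))];
    try assumption.
  all: try (intros t Ht; specialize (Hder t Ht); revert Hder; apply filter_imp;
    intros [r v] Hq; apply is_derive_C_components in Hq; apply Hq).
  all: try (revert Hex; apply filter_imp; intros r [l Hl]; apply is_CInt_components in Hl;
    eexists; apply Hl).
  all: intros t Ht; specialize (Hdf t Ht); apply continuous_C_components in Hdf;
    destruct Hdf as [H1 H2].
  - revert H1; apply continuous_ext; intros []; reflexivity.
  - revert H2; apply continuous_ext; intros []; reflexivity.
Qed.

Lemma continuous_RInt_param (f : R -> R -> R) (a b s : R) : a <= b ->
  (forall t, a <= t <= b ->
     continuous (fun q : R * R => f (fst q) (snd q)) (s, t)) ->
  locally s (fun r => ex_RInt (f r) a b) ->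
  continuous (fun r => RInt (f r) a b) s.
Proof.
  intros Hab Hf Hex; apply filterlim_locally; intros eps.
  assert (He : 0 < eps / (b - a + 1)) by
    (apply Rdiv_lt_0_compat; [apply cond_pos|lra]).
  destruct (uniform_continuity_2d_1d' f a b s
    (fun t Ht => proj2 (continuity_2d_pt_filterlim f s t) (Hf t Ht))
    (mkposreal _ He)) as [d Hd].
  assert (Hd' : locally s (fun r => Rabs (r - s) < d)) by now exists d.
  generalize (filter_and _ _ Hd' Hex); apply filter_imp; intros r [Hr Hexr].
  assert (Hexs := locally_singleton _ _ Hex).
  apply Rabs_lt_between in Hr.
  change (Rabs (minus (RInt (f r) a b) (RInt (f s) a b)) < eps).
  rewrite <- (RInt_minus (V := R_CompleteNormedModule)) by assumption.
  apply Rle_lt_trans with ((b - a) * (eps / (b - a + 1))).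
  - apply abs_RInt_le_const; [assumption|now apply (ex_RInt_minus (V := R_NormedModule))|].
    intros t Ht; apply Rlt_le, (Hd t s t r); try lra; assert (Hp := cond_pos d); try lra.
    rewrite Rminus_diag, Rabs_R0; exact Hp.
  - apply Rlt_le_trans with ((b - a + 1) * (eps / (b - a + 1))); [nra|].
    right; field; lra.
Qed.

Lemma continuous_CInt_param (f : R * R -> C) (a b s : R) : a <= b ->
  (forall t, a <= t <= b -> locally (s, t) (fun q => Ccont f q)) ->
  Ccont (fun r => CInt (fun t => f (r, t)) a b) s.
Proof.
  intros Hab Hf.
  assert (Hex : locally s (fun r => ex_CInt (fun t => f (r, t)) a b)).
  { apply (filter_imp (fun r => forall t, a <= t <= b -> Ccont f (r, t))).
    - intros r Hr; apply ex_CInt_continuous; [assumption|].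
      intros t Ht; now apply continuous_slice, Hr.
    - now apply locally_forall_segment. }
  apply (continuous_ext_loc (U := C_UniformSpace) _ (fun r =>
    (RInt (fun t => fst (f (r, t))) a b, RInt (fun t => snd (f (r, t))) a b))).
  { apply (filter_imp _ _ (fun r Hr => eq_sym (CInt_components _ a b Hr)) Hex). }
  apply continuous_C_components; split; simpl;
    [apply (continuous_RInt_param (fun r t => fst (f (r, t))))
    |apply (continuous_RInt_param (fun r t => snd (f (r, t))))];
    try assumption.
  all: try (revert Hex; apply filter_imp; intros r [l Hl]; apply is_CInt_components in Hl;
    eexists; apply Hl).
  all: intros t Ht; assert (Hs := locally_singleton _ _ (Hf t Ht));
    apply continuous_C_components in Hs; destruct Hs as [H1 H2].
  - revert H1; apply continuous_ext; intros []; reflexivity.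
  - revert H2; apply continuous_ext; intros []; reflexivity.
Qed.

(** * Contracting a contour towards a point *)

Lemma Cderiv_continuous (p : R -> C) (t : R) (d : C) : Cderiv p t d -> Ccont p t.
Proof.
  intros H; apply (ex_derive_continuous (K := R_AbsRing) (V := C_R_NormedModule)).
  now exists d.
Qed.

Lemma Cderiv_eq (p : R -> C) (t : R) (d d' : C) :
  Cderiv p t d -> d = d' -> Cderiv p t d'.
Proof. now intros H <-. Qed.

(** Complex differentiability in the form in which the contraction uses it: a
    chain rule along real curves, within the real normed structure of C. *)
Definition derivative_along_curves (k dk : C -> C) (c : C) : Prop :=
  forall (p : R -> C) (t : R) (dp : C), p t = c -> Cderiv p t dp ->
  Cderiv (fun r => k (p r)) t (dk c * dp)%C.

Definition holomorphic_at (k dk : C -> C) (c : C) : Prop :=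
  derivative_along_curves k dk c /\ Ccont k c /\ Ccont dk c.

Definition smooth_curve_at (u du : R -> C) (t : R) : Prop :=
  Cderiv u t (du t) /\ Ccont du t.

Lemma continuous_scaled_curve (u : R -> C) (s t : R) :
  Ccont u t -> Ccont (fun q : R * R => (RtoC (fst q) * u (snd q))%C) (s, t).
Proof.
  intros Hu; apply continuous_Cmult.
  - apply continuous_RtoC, continuous_fst.
  - apply (continuous_comp snd u); [apply continuous_snd|exact Hu].
Qed.

Lemma locally_snd {U V : UniformSpace} (P : V -> Prop) (s : U) (t : V) :
  locally t P -> locally (s, t) (fun q : U * V => P (snd q)).
Proof.
  intros H; exact (continuous_snd s t P H).
Qed.

Lemma locally_Cneq_0 {T : UniformSpace} (f : T -> C) (x : T) :
  Ccont f x -> f x <> RtoC 0 -> locally x (fun t => f t <> RtoC 0).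
Proof.
  intros Hf H0.
  assert (Hd : 0 < Cmod (f x) / 2) by (apply Cmod_gt_0 in H0; lra).
  assert (Hs : 0 < Cmod (f x) / sqrt 2) by
    (apply Rdiv_lt_0_compat; [now apply Cmod_gt_0|apply Rlt_sqrt2_0]).
  assert (H := proj1 (filterlim_locally f (f x)) Hf (mkposreal _ Hs)).
  revert H; apply filter_imp; intros t Ht E; rewrite E in Ht.
  apply C_NormedModule_mixin_compat2 in Ht; simpl in Ht.
  replace (sqrt 2 * (Cmod (f x) / sqrt 2)) with (Cmod (f x)) in Ht.
  - revert Ht; apply Rle_not_lt; right.
    rewrite <- (Cmod_opp (f x)); f_equal.
    change (- f x = RtoC 0 - f x)%C; ring.
  - field; apply Rgt_not_eq, Rlt_sqrt2_0.
Qed.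

(** The integrand f(s u) u' / u has s-derivative f'(s u) u', which is the
    t-derivative of f(s u) / s. So the derivative of the integral depends only on
    the end points of the curve, and cancels on a closed contour. *)
Lemma is_derive_contracted_integral (f df : C -> C) (u du : R -> C) (a b s : R) :
  a <= b -> s <> 0 ->
  (forall t, a <= t <= b -> locally t (smooth_curve_at u du)) ->
  (forall t, a <= t <= b -> u t <> RtoC 0) ->
  (forall t, a <= t <= b ->
     locally (T := C_UniformSpace) (RtoC s * u t)%C (holomorphic_at f df)) ->
  Cderiv (fun r => CInt (fun t => (f (RtoC r * u t) * (du t / u t))%C) a b) s
    ((f (RtoC s * u b) - f (RtoC s * u a)) / RtoC s)%C.
Proof.
  intros Hab Hs Hu Hu0 Hf.
  assert (Hs' : RtoC s <> RtoC 0) by (intros E; now apply RtoC_inj in E).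
  assert (Hcu : forall t, a <= t <= b -> Ccont u t).
  { intros t Ht; apply Cderiv_continuous with (du t), (locally_singleton _ _ (Hu t Ht)). }
  assert (Hloc : forall t, a <= t <= b -> locally (s, t) (fun q : R * R =>
    holomorphic_at f df (RtoC (fst q) * u (snd q))%C /\
    smooth_curve_at u du (snd q) /\ u (snd q) <> RtoC 0)).
  { intros t Ht; apply filter_and; [|apply filter_and].
    - apply (continuous_scaled_curve u s t (Hcu t Ht)), Hf, Ht.
    - apply locally_snd; auto.
    - apply (locally_snd (fun v => u v <> RtoC 0)), locally_Cneq_0; auto. }
  set (dF := fun q : R * R => (df (RtoC (fst q) * u (snd q)) * du (snd q))%C).
  assert (HdF : forall t, a <= t <= b -> Ccont dF (s, t)).
  { intros t Ht; destruct (locally_singleton _ _ (Hloc t Ht)) as [[_ [_ H1]] [[H2 H3] _]].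
    apply continuous_Cmult.
    - apply (continuous_comp (fun q : R * R => (RtoC (fst q) * u (snd q))%C) df);
        [now apply continuous_scaled_curve, Hcu|exact H1].
    - apply (continuous_comp snd du); [apply continuous_snd|exact H3]. }
  assert (HI : is_CInt (fun t => dF (s, t)) a b
    ((f (RtoC s * u b) - f (RtoC s * u a)) / RtoC s)%C).
  { replace ((f (RtoC s * u b) - f (RtoC s * u a)) / RtoC s)%C with
      (minus (G := C_R_NormedModule) (/ RtoC s * f (RtoC s * u b))%C (/ RtoC s * f (RtoC s * u a))%C).
    2:{ change (/ RtoC s * f (RtoC s * u b) - / RtoC s * f (RtoC s * u a) =
        (f (RtoC s * u b) - f (RtoC s * u a)) / RtoC s)%C; now field. }
    apply (is_RInt_derive (V := C_R_CompleteNormedModule)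
      (fun t => (/ RtoC s * f (RtoC s * u t))%C)).
    - rewrite Rmin_left, Rmax_right by assumption; intros t Ht.
      destruct (locally_singleton _ _ (Hloc t Ht)) as [[H1 _] [[H2 _] _]]; simpl in *.
      unfold dF; simpl.
      assert (HD := is_derive_Cmult _ _ _ _ _ (is_derive_Cconst (RtoC s) t) H2).
      assert (HE := is_derive_Cmult _ _ _ _ _ (is_derive_Cconst (/ RtoC s)%C t)
        (H1 (fun t => (RtoC s * u t)%C) t _ eq_refl HD)); simpl in HE.
      apply (Cderiv_eq _ _ _ _ HE); now field.
    - rewrite Rmin_left, Rmax_right by assumption; intros t Ht.
      now apply (continuous_slice dF), HdF. }
  rewrite <- (is_RInt_unique (V := C_R_CompleteNormedModule) _ _ _ _ HI).
  apply (is_derive_CInt_param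
    (fun q => (f (RtoC (fst q) * u (snd q)) * (du (snd q) / u (snd q)))%C) dF); [assumption| |assumption|].
  - intros t Ht; generalize (Hloc t Ht); apply filter_imp.
    intros [r v] [[H1 _] [[H2 _] H3]]; unfold dF; simpl in *.
    assert (HD := is_derive_Cmult _ _ _ _ _ (is_derive_RtoC r)
      (is_derive_Cconst (u v) r)).
    assert (HE := is_derive_Cmult _ _ _ _ _
      (H1 (fun r => (RtoC r * u v)%C) r _ eq_refl HD) (is_derive_Cconst (du v / u v)%C r)); simpl in HE.
    apply (Cderiv_eq _ _ _ _ HE); now field.
  - intros t Ht; generalize (Hloc t Ht); apply filter_imp.
    intros [r v] [[_ [H1 _]] [[H2 H3] H4]]; simpl in *.
    assert (H5 : Ccont u v) by (eapply Cderiv_continuous; exact H2).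
    apply continuous_Cmult.
    + apply (continuous_comp (fun q : R * R => (RtoC (fst q) * u (snd q))%C) f);
        [now apply continuous_scaled_curve|exact H1].
    + apply continuous_Cdiv; [| |exact H4].
      * apply (continuous_comp snd du); [apply continuous_snd|exact H3].
      * apply (continuous_comp snd u); [apply continuous_snd|exact H5].
Qed.

Lemma continuous_contracted_integral (f : C -> C) (u du : R -> C) (a b : R) :
  a <= b ->
  (forall t, a <= t <= b -> locally t (smooth_curve_at u du)) ->
  (forall t, a <= t <= b -> u t <> RtoC 0) ->
  locally (T := C_UniformSpace) (RtoC 0) (fun c => Ccont f c) ->
  Ccont (fun r => CInt (fun t => (f (RtoC r * u t) * (du t / u t))%C) a b) 0.
Proof.
  intros Hab Hu Hu0 Hf.
  assert (Hcu : forall t, a <= t <= b -> Ccont u t).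
  { intros t Ht; apply Cderiv_continuous with (du t), (locally_singleton _ _ (Hu t Ht)). }
  assert (Hloc : forall t, a <= t <= b -> locally (0, t) (fun q : R * R =>
    Ccont f (RtoC (fst q) * u (snd q))%C /\
    smooth_curve_at u du (snd q) /\ u (snd q) <> RtoC 0)).
  { intros t Ht; apply filter_and; [|apply filter_and].
    - apply (continuous_scaled_curve u 0 t (Hcu t Ht)); simpl.
      rewrite Cmult_0_l; exact Hf.
    - apply locally_snd; auto.
    - apply (locally_snd (fun v => u v <> RtoC 0)), locally_Cneq_0; auto. }
  assert (Hloc' : forall t, a <= t <= b -> locally (0, t) (fun q : R * R =>
    Ccont (fun q => (f (RtoC (fst q) * u (snd q)) * (du (snd q) / u (snd q)))%C) q)).
  { intros t Ht; generalize (Hloc t Ht); apply filter_imp.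
    intros [r v] [H1 [[H2 H3] H4]]; simpl in *.
    assert (H5 : Ccont u v) by (eapply Cderiv_continuous; exact H2).
    apply continuous_Cmult.
    + apply (continuous_comp (fun q : R * R => (RtoC (fst q) * u (snd q))%C) f);
        [now apply continuous_scaled_curve|exact H1].
    + apply continuous_Cdiv; [| |exact H4].
      * apply (continuous_comp snd du); [apply continuous_snd|exact H3].
      * apply (continuous_comp snd u); [apply continuous_snd|exact H5]. }
  apply (continuous_CInt_param
    (fun q => (f (RtoC (fst q) * u (snd q)) * (du (snd q) / u (snd q)))%C)); assumption.
Qed.

(** The parameter 0 is the end of the contraction, which is reached by continuity
    only. *)
Lemma constant_of_zero_derivative (T : R -> C) :
  (forall s, 0 < s <= 1 -> Cderiv T s (RtoC 0)) -> Ccont T 0 -> T 1 = T 0.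
Proof.
  intros HD HC.
  assert (HR : forall f : R -> R, (forall s, 0 < s <= 1 -> is_derive f s 0) ->
    continuous f 0 -> f 1 = f 0).
  { intros f Hd Hc.
    destruct (MVT_gen f 0 1 (fun _ => 0)) as [c [_ Hc']].
    - rewrite Rmin_left, Rmax_right by lra; intros x Hx; apply Hd; lra.
    - rewrite Rmin_left, Rmax_right by lra; intros x Hx.
      apply continuity_pt_filterlim.
      destruct (Req_dec x 0) as [->|n]; [exact Hc|].
      apply (ex_derive_continuous (K := R_AbsRing) (V := R_NormedModule)).
      exists 0; apply Hd; lra.
    - lra. }
  apply continuous_C_components in HC; destruct HC as [H1 H2].
  apply injective_projections;
    [apply (HR (fun s => fst (T s)))|apply (HR (fun s => snd (T s)))]; try assumption;
    intros s Hs; specialize (HD s Hs); apply is_derive_C_components in HD; apply HD.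
Qed.

(** * The map c e^c on a horizontal strip *)

Definition lambert (c : C) : C := (c * Cexp c)%C.

Lemma Re_lambert (c : C) :
  Re (lambert c) = exp (Re c) * (Re c * cos (Im c) - Im c * sin (Im c)).
Proof. unfold lambert, Cexp, Re, Im; simpl; ring. Qed.

Lemma Im_lambert (c : C) :
  Im (lambert c) = exp (Re c) * (Re c * sin (Im c) + Im c * cos (Im c)).
Proof. unfold lambert, Cexp, Re, Im; simpl; ring. Qed.

Lemma lambert_conj (c : C) : lambert (Cconj c) = Cconj (lambert c).
Proof.
  unfold lambert, Cexp, Cconj, Re, Im; simpl; rewrite cos_neg, sin_neg.
  apply injective_projections; simpl; ring.
Qed.

Lemma ex_derive_continuity_pt (f : R -> R) (x : R) :
  ex_derive f x -> continuity_pt f x.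
Proof.
  intros H; apply continuity_pt_filterlim.
  exact (ex_derive_continuous (K := R_AbsRing) (V := R_NormedModule) f x H).
Qed.

(** The difference vanishes at 0 and has derivative y sin y. *)
Lemma cos_le_sin_over (y : R) : 0 <= y <= PI -> y * cos y <= sin y.
Proof.
  intros Hy.
  destruct (MVT_gen (fun y => sin y - y * cos y) 0 y (fun y => y * sin y))
    as [c [Hc E]].
  - intros x _; auto_derive; trivial; ring.
  - intros x _; apply ex_derive_continuity_pt.
    auto_derive; trivial.
  - rewrite Rmin_left, Rmax_right in Hc by lra.
    rewrite sin_0, cos_0 in E.
    assert (0 <= sin c) by (apply sin_ge_0; lra).
    assert (0 <= c * sin c * (y - 0)) by (apply Rmult_le_pos; nra).
    lra.
Qed.

(** This is the slope of the chord from (-1, 0) to the point at height y of the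
    curve x = - y cot y. Its derivative is 1 / sin^2 - 1 / y^2 >= 0. *)
Lemma chord_slope_increasing (x y : R) : 0 < x <= y -> y < PI ->
  / x - cos x / sin x <= / y - cos y / sin y.
Proof.
  intros Hx Hy.
  destruct (Req_dec x y) as [->|n]; [lra|].
  assert (Hs : forall t, x <= t <= y -> 0 < sin t) by
    (intros t Ht; apply sin_gt_0; lra).
  destruct (MVT_gen (fun y => / y - cos y / sin y) x y
    (fun y => / (sin y) ^ 2 - / y ^ 2)) as [c [Hc E]];
    rewrite Rmin_left, Rmax_right in * by lra.
  - intros t Ht; assert (H := Hs t ltac:(lra)).
    auto_derive; [repeat split; lra|].
    assert (H2 : cos t ^ 2 = 1 - sin t ^ 2) by
      (assert (H3 := sin2_cos2 t); unfold Rsqr in H3; lra).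
    field_simplify; [|lra|lra]. rewrite H2; field; lra.
  - intros t Ht; apply ex_derive_continuity_pt.
    assert (H := Hs t Ht); auto_derive; repeat split; lra.
  - assert (H := Hs c Hc).
    assert (sin c < c) by (apply sin_lt_x; lra).
    assert (/ c ^ 2 <= / sin c ^ 2) by (apply Rinv_le_contravar; nra).
    assert (0 <= (/ sin c ^ 2 - / c ^ 2) * (y - x)) by (apply Rmult_le_pos; lra).
    lra.
Qed.

(** For 0 < y < PI the region x >= - y cot y reads x sin y + y cos y >= 0, a form
    without division that is also the sign of Im (lambert c). By monotonicity of
    the chord slopes, it is stable under moving towards the half-line x >= -1 of
    the real axis. *)
Lemma upper_region_star_shaped (x0 y0 s x : R) :
  0 < y0 < PI -> 0 <= x0 * sin y0 + y0 * cos y0 -> 0 < s <= 1 ->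
  s * (1 + x0) <= 1 + x ->
  0 <= x * sin (s * y0) + s * y0 * cos (s * y0).
Proof.
  intros Hy H0 Hs Hx.
  assert (Hsy : 0 < s * y0 <= y0) by nra.
  assert (Hk := chord_slope_increasing (s * y0) y0 Hsy (proj2 Hy)).
  assert (S0 : 0 < sin y0) by (apply sin_gt_0; lra).
  assert (S1 : 0 < sin (s * y0)) by (apply sin_gt_0; lra).
  assert (H1 : y0 * (/ y0 - cos y0 / sin y0) <= 1 + x0).
  { apply (Rmult_le_reg_r (sin y0)); [exact S0|].
    replace (y0 * (/ y0 - cos y0 / sin y0) * sin y0) with (sin y0 - y0 * cos y0)
      by (field; lra). lra. }
  assert (H2 : s * y0 * (/ (s * y0) - cos (s * y0) / sin (s * y0)) <= 1 + x).
  { apply Rle_trans with (s * (y0 * (/ y0 - cos y0 / sin y0))).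
    - rewrite Rmult_assoc; apply Rmult_le_compat_l; [lra|].
      apply Rmult_le_compat_l; [lra|exact Hk].
    - apply Rle_trans with (s * (1 + x0)); [|exact Hx].
      apply Rmult_le_compat_l; [lra|exact H1]. }
  apply (Rmult_le_compat_r (sin (s * y0))) in H2; [|lra].
  replace (s * y0 * (/ (s * y0) - cos (s * y0) / sin (s * y0)) * sin (s * y0))
    with (sin (s * y0) - s * y0 * cos (s * y0)) in H2 by (field; lra).
  lra.
Qed.

Lemma upper_region_Re_ge_m1 (x y : R) : 0 < y < PI -> 0 <= x * sin y + y * cos y -> -1 <= x.
Proof.
  intros Hy H; assert (H1 := cos_le_sin_over y ltac:(lra)).
  assert (0 < sin y) by (apply sin_gt_0; lra). nra.
Qed.

(** With [upper_arg], the logarithm of x + i y for y > 0; atan (x / y) is smooth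
    across the vertical axis, where atan (y / x) jumps. *)
Definition log_modulus (x y : R) : R := ln (x ^ 2 + y ^ 2) / 2.
Definition upper_arg (x y : R) : R := PI / 2 - atan (x / y).

Lemma sum_sqr_pos (x y : R) : 0 < y -> 0 < x ^ 2 + y ^ 2.
Proof. intros H; assert (H1 := pow2_ge_0 x); assert (H2 := pow_lt y 2 H); lra. Qed.

Lemma upper_polar (x y : R) : 0 < y ->
  exp (log_modulus x y) * cos (upper_arg x y) = x /\
  exp (log_modulus x y) * sin (upper_arg x y) = y.
Proof.
  intros Hy; unfold log_modulus, upper_arg.
  rewrite cos_shift, sin_shift, sin_atan, cos_atan.
  assert (H := sum_sqr_pos x y Hy).
  assert (E : exp (ln (x ^ 2 + y ^ 2) / 2) = sqrt (x ^ 2 + y ^ 2)).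
  { rewrite <- (sqrt_square (exp _)) by (left; apply exp_pos).
    rewrite <- exp_plus, <- Rdiv_plus_distr.
    replace ((ln (x ^ 2 + y ^ 2) + ln (x ^ 2 + y ^ 2)) / 2) with (ln (x ^ 2 + y ^ 2)) by field.
    now rewrite exp_ln. }
  assert (F : sqrt (x ^ 2 + y ^ 2) = y * sqrt (1 + (x / y)²)).
  { rewrite <- (sqrt_square y) at 2 by lra.
    rewrite <- sqrt_mult_alt by nra. f_equal; unfold Rsqr; field; lra. }
  rewrite E, F.
  assert (0 < sqrt (1 + (x / y)²)) by (apply sqrt_lt_R0; assert (H1 := Rle_0_sqr (x / y)); lra).
  split; field; lra.
Qed.

(** In the upper half-plane the derivative 1 + 1/c of c + log c has negative
    imaginary part. Hence, if e is the difference of two points, the function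
    Im (conj(e) (c + log c)) strictly decreases along the segment joining them. *)
Lemma log_lambert_injective (x1 y1 x2 y2 : R) : 0 < y1 -> 0 < y2 ->
  x1 + log_modulus x1 y1 = x2 + log_modulus x2 y2 ->
  y1 + upper_arg x1 y1 = y2 + upper_arg x2 y2 -> x1 = x2 /\ y1 = y2.
Proof.
  intros H1 H2 E1 E2; apply NNPP; intros Hne.
  set (a := x2 - x1); set (b := y2 - y1).
  assert (Hab : 0 < a ^ 2 + b ^ 2).
  { destruct (Req_dec a 0); [|nra]. destruct (Req_dec b 0); [|nra].
    exfalso; apply Hne; unfold a, b in *; lra. }
  assert (Hy : forall t, 0 <= t <= 1 -> 0 < y1 + t * b) by
    (intros t Ht; unfold b; clear - Ht H1 H2; destruct (Rle_lt_dec t 0); nra).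
  destruct (MVT_gen (fun t => a * (y1 + t * b + upper_arg (x1 + t * a) (y1 + t * b))
      - b * (x1 + t * a + log_modulus (x1 + t * a) (y1 + t * b))) 0 1
    (fun t => - (a ^ 2 + b ^ 2) * ((y1 + t * b) /
       ((x1 + t * a) ^ 2 + (y1 + t * b) ^ 2)))) as [c [Hc E]];
    rewrite Rmin_left, Rmax_right in * by lra.
  - intros t Ht; assert (H := Hy t ltac:(lra)); unfold upper_arg, log_modulus.
    assert (H3 := sum_sqr_pos (x1 + t * a) (y1 + t * b) H).
    auto_derive; [repeat split; try lra|].
    unfold Rsqr; field; repeat split; nra.
  - intros t Ht; apply ex_derive_continuity_pt.
    assert (H := Hy t ltac:(lra)); unfold upper_arg, log_modulus.
    assert (H3 := sum_sqr_pos (x1 + t * a) (y1 + t * b) H).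
    auto_derive; repeat split; try lra.
  - replace (x1 + 1 * a) with x2 in E by (unfold a; ring).
    replace (y1 + 1 * b) with y2 in E by (unfold b; ring).
    replace (x1 + 0 * a) with x1 in E by ring.
    replace (y1 + 0 * b) with y1 in E by ring.
    rewrite E1, E2 in E.
    assert (H := Hy c Hc).
    assert (0 < (y1 + c * b) / ((x1 + c * a) ^ 2 + (y1 + c * b) ^ 2)) by
      (apply Rdiv_lt_0_compat; [exact H|now apply sum_sqr_pos]).
    nra.
Qed.

Lemma angle_unique (s t : R) : - (2 * PI) < s - t < 2 * PI ->
  cos s = cos t -> sin s = sin t -> s = t.
Proof.
  intros H Hc Hs.
  assert (E : sin ((s - t) / 2) = 0).
  { assert (E1 : cos (2 * ((s - t) / 2)) = 1).
    { replace (2 * ((s - t) / 2)) with (s - t) by field.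
      rewrite cos_minus, Hc, Hs; assert (H1 := sin2_cos2 t); unfold Rsqr in H1; lra. }
    rewrite cos_2a_sin in E1; nra. }
  destruct (Rtotal_order s t) as [L|[L|L]]; [|exact L|].
  - assert (0 < sin (- ((s - t) / 2))) by (apply sin_gt_0; lra).
    rewrite sin_neg in H0; lra.
  - assert (0 < sin ((s - t) / 2)) by (apply sin_gt_0; lra). lra.
Qed.

(** Equality of c e^c determines c + log c up to a multiple of 2 i PI, and there
    is no room for a non-zero multiple: both imaginary parts are in ]0, 2 PI[. *)
Lemma lambert_injective_upper (c d : C) :
  0 < Im c < PI -> 0 < Im d < PI -> lambert c = lambert d -> c = d.
Proof.
  intros Hc Hd E.
  assert (Hpol : forall c : C, 0 < Im c ->
    Re (lambert c) = exp (Re c + log_modulus (Re c) (Im c)) *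
       cos (Im c + upper_arg (Re c) (Im c)) /\
    Im (lambert c) = exp (Re c + log_modulus (Re c) (Im c)) *
       sin (Im c + upper_arg (Re c) (Im c))).
  { clear; intros c Hc; rewrite Re_lambert, Im_lambert, exp_plus, cos_plus, sin_plus.
    destruct (upper_polar (Re c) (Im c) Hc) as [H1 H2].
    set (co := cos (upper_arg (Re c) (Im c))) in *.
    set (si := sin (upper_arg (Re c) (Im c))) in *.
    set (m := exp (log_modulus (Re c) (Im c))) in *.
    split.
    - replace (Re c * cos (Im c) - Im c * sin (Im c)) with
        (m * co * cos (Im c) - m * si * sin (Im c)) by now rewrite H1, H2.
      ring.
    - replace (Re c * sin (Im c) + Im c * cos (Im c)) with
        (m * co * sin (Im c) + m * si * cos (Im c)) by now rewrite H1, H2.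
      ring. }
  destruct (Hpol c (proj1 Hc)) as [C1 C2], (Hpol d (proj1 Hd)) as [D1 D2].
  rewrite <- E, C1 in D1; rewrite <- E, C2 in D2.
  set (Lc := Re c + log_modulus (Re c) (Im c)) in *.
  set (Ld := Re d + log_modulus (Re d) (Im d)) in *.
  set (Tc := Im c + upper_arg (Re c) (Im c)) in *.
  set (Td := Im d + upper_arg (Re d) (Im d)) in *.
  assert (Hmod : exp Lc = exp Ld).
  { assert (H1 := exp_pos Lc); assert (H2 := exp_pos Ld).
    assert (H3 := sin2_cos2 Tc); assert (H4 := sin2_cos2 Td); unfold Rsqr in *.
    assert (H5 : exp Lc * exp Lc = exp Ld * exp Ld).
    { transitivity (exp Lc * exp Lc * (sin Tc * sin Tc + cos Tc * cos Tc)); [rewrite H3; ring|].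
      transitivity (exp Ld * exp Ld * (sin Td * sin Td + cos Td * cos Td)); [|rewrite H4; ring].
      transitivity (exp Lc * sin Tc * (exp Lc * sin Tc) + exp Lc * cos Tc * (exp Lc * cos Tc));
        [ring|rewrite D1, D2; ring]. }
    nra. }
  assert (Hl : Lc = Ld) by now apply exp_inv.
  assert (Ht : Tc = Td).
  { assert (H1 := exp_pos Ld); rewrite Hmod in D1, D2.
    apply angle_unique.
    - unfold Tc, Td, upper_arg.
      assert (H2 := atan_bound (Re c / Im c)); assert (H3 := atan_bound (Re d / Im d)); lra.
    - apply (Rmult_eq_reg_l (exp Ld)); lra.
    - apply (Rmult_eq_reg_l (exp Ld)); lra. }
  destruct (log_lambert_injective (Re c) (Im c) (Re d) (Im d)) as [H1 H2];
    [lra|lra|exact Hl|exact Ht|].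
  now apply injective_projections.
Qed.

(** The closure of the range of the principal branch. For Im c <> 0 the last
    condition says that c is on or to the right of the curve x = - y cot y; on the
    real axis the second one takes over. *)
Definition principal_region (c : C) : Prop :=
  - PI < Im c < PI /\ -1 <= Re c /\ 0 <= Im c * Im (lambert c).

Lemma principal_region_conj (c : C) :
  principal_region c -> principal_region (Cconj c).
Proof.
  unfold principal_region; rewrite lambert_conj; unfold Cconj, Re, Im; simpl.
  intros [H1 [H2 H3]]; repeat split; lra.
Qed.

(** Vanishing of the imaginary part means x = - y cot y, and then
    c e^c = - e^x y / sin y. *)
Lemma lambert_real_negative (c : C) :
  - PI < Im c < PI -> Im c <> 0 -> Im (lambert c) = 0 -> Re (lambert c) < 0.
Proof.
  rewrite Re_lambert, Im_lambert; set (x := Re c); set (y := Im c); intros Hy H0 E.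
  assert (He := exp_pos x).
  assert (E' : x * sin y + y * cos y = 0) by nra.
  assert (Hs : 0 < y * sin y).
  { destruct (Rlt_le_dec 0 y).
    - assert (0 < sin y) by (apply sin_gt_0; lra). nra.
    - assert (0 < sin (- y)) by (apply sin_gt_0; lra). rewrite sin_neg in *. nra. }
  assert (H1 := sin2_cos2 y); unfold Rsqr in H1.
  assert (H2 : (x * cos y - y * sin y) * (y * sin y) = - (y * y)).
  { replace ((x * cos y - y * sin y) * (y * sin y)) with
      ((x * sin y + y * cos y) * (y * cos y) - y * y * (sin y * sin y + cos y * cos y)) by ring.
    rewrite E', H1; ring. }
  assert (x * cos y - y * sin y < 0) by nra.
  nra.
Qed.

Lemma lambert_injective_positive (x y : R) : 0 < x -> 0 < y ->
  exp x * x = exp y * y -> x = y.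
Proof.
  intros Hx Hy E; destruct (Rtotal_order x y) as [L|[L|L]]; [|exact L|];
    apply exp_increasing in L as L'; assert (H1 := exp_pos x);
    assert (H2 := exp_pos y); nra.
Qed.

Lemma between_strict (l x y s r : R) :
  l < x < r -> l < y < r -> 0 <= s <= 1 -> l < x + s * (y - x) < r.
Proof.
  intros Hx Hy Hs; destruct (Rle_lt_dec s 0) as [H|H].
  - replace s with 0 by lra; lra.
  - assert (s * (l - y) < 0) by nra. assert (0 < s * (r - y)) by nra.
    assert (0 <= (1 - s) * (x - l)) by nra. assert (0 <= (1 - s) * (r - x)) by nra.
    split; nra.
Qed.

(** Suppose that Im (lambert w) > 0. A point c of the segment with the same image
    cannot be real; above the real axis injectivity gives c = w. Below it, p is
    also below, and c is to the right of the boundary curve because that part of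
    the segment starts on the real axis at a point x >= -1; so
    Im (lambert c) <= 0. Conjugation handles Im (lambert w) < 0. When lambert w is
    a positive real, every solution in the strip is a positive real. *)
Lemma segment_no_other_preimage (w p : C) (s : R) :
  slit_plane 0 (lambert w) -> principal_region w -> principal_region p ->
  0 <= s <= 1 -> let c := (w + RtoC s * (p - w))%C in
  lambert c = lambert w -> c = w.
Proof.
  intros Hz Hw Hp Hs c E.
  assert (Hup : forall w p : C, 0 < Im (lambert w) ->
    principal_region w -> principal_region p ->
    lambert (w + RtoC s * (p - w))%C = lambert w -> (w + RtoC s * (p - w))%C = w).
  { clear - Hs; intros w p Hz [W1 [W2 W3]] [P1 [P2 P3]] E.
    set (c := (w + RtoC s * (p - w))%C) in *.
    assert (Cx : Re c = Re w + s * (Re p - Re w)) by (unfold c, Re, Im; simpl; ring).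
    assert (Cy : Im c = Im w + s * (Im p - Im w)) by (unfold c, Re, Im; simpl; ring).
    assert (Wy : 0 < Im w).
    { destruct (Req_dec (Im w) 0) as [E0|]; [|nra].
      rewrite Im_lambert, E0, sin_0, cos_0 in Hz; lra. }
    assert (Bc : - PI < Im c < PI) by (rewrite Cy; now apply between_strict).
    destruct (Rtotal_order (Im c) 0) as [L|[L|L]].
    - exfalso.
      assert (Py : Im p < 0) by nra.
      (* c has height r times that of p, and lies to the right of the point at
         this height on the segment from -1 to p *)
      set (r := Im c / Im p).
      assert (Hr : Im c = r * Im p) by (unfold r; field; lra).
      assert (Hrs : r <= s).
      { assert (0 <= (r - s) * Im p) by
          (replace ((r - s) * Im p) with ((1 - s) * Im w) by lra; nra).
        nra. }
      assert (Hr0 : 0 < r) by nra.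
      rewrite Im_lambert in P3; rewrite <- E, Im_lambert in Hz.
      assert (He := exp_pos (Re p)); assert (He' := exp_pos (Re c)).
      assert (P4 : 0 <= Re p * - sin (Im p) + - Im p * cos (Im p)).
      { assert (exp (Re p) * (Re p * sin (Im p) + Im p * cos (Im p)) <= 0) by nra.
        nra. }
      assert (H := upper_region_star_shaped (Re p) (- Im p) r (Re c) ltac:(lra)).
      replace (r * - Im p) with (- Im c) in H by lra.
      rewrite !sin_neg, !cos_neg in H.
      assert (H' : 0 <= Re c * - sin (Im c) + - Im c * cos (Im c)) by
        (apply H; [exact P4|lra|nra]).
      nra.
    - exfalso; rewrite <- E, Im_lambert, L, sin_0, cos_0 in Hz; lra.
    - apply lambert_injective_upper; try lra; exact E. }
  destruct (Rtotal_order (Im (lambert w)) 0) as [L|[L|L]].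
  - assert (H := Hup (Cconj w) (Cconj p)).
    rewrite lambert_conj in H.
    assert (Ec : (Cconj w + RtoC s * (Cconj p - Cconj w))%C = Cconj c).
    { unfold c; apply injective_projections; unfold Cconj; simpl; ring. }
    rewrite Ec, lambert_conj, E in H.
    rewrite <- (Cconj_conj c), <- (Cconj_conj w) at 1; f_equal.
    apply H; try now apply principal_region_conj.
    + change (0 < - Im (lambert w)); lra.
    + reflexivity.
  - assert (Hre : 0 < Re (lambert w)) by (apply Rnot_le_lt; intros Hre; apply Hz; now split).
    assert (Bc : - PI < Im c < PI).
    { replace (Im c) with (Im w + s * (Im p - Im w)) by (unfold c, Re, Im; simpl; ring).
      apply between_strict; [apply Hw|apply Hp|exact Hs]. }
    assert (Hreal : forall c : C, - PI < Im c < PI -> lambert c = lambert w -> Im c = 0).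
    { intros d Hd Ed; apply NNPP; intros Hd0.
      assert (H := lambert_real_negative d Hd Hd0); rewrite Ed in H; lra. }
    assert (C0 := Hreal c Bc E); assert (W0 := Hreal w (proj1 Hw) eq_refl).
    assert (Ere : Re (lambert c) = Re (lambert w)) by now rewrite E.
    rewrite Re_lambert, W0, sin_0, cos_0 in Hre.
    rewrite !Re_lambert, W0, C0, sin_0, cos_0 in Ere.
    assert (H1 := exp_pos (Re c)); assert (H2 := exp_pos (Re w)).
    apply injective_projections; [|unfold Im in *; lra].
    apply lambert_injective_positive; unfold Re in *; nra.
  - now apply Hup.
Qed.

(** * The principal branch takes its values in the principal region *)

Lemma intermediate_value (f : R -> R) (a b v : R) : a <= b ->
  (forall x, a <= x <= b -> continuous f x) -> f a < v -> v <= f b ->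
  exists x, a <= x <= b /\ f x = v.
Proof.
  intros Hab Hc Ha Hb.
  destruct (Req_dec (f b) v) as [E|n]; [exists b; split; [lra|exact E]|].
  destruct (Req_dec a b) as [E|n']; [subst; lra|].
  destruct (Ranalysis5.IVT_interv (fun x => f x - v) a b) as [x [Hx E]]; try lra.
  - intros x Hx; apply continuity_pt_filterlim.
    apply (continuous_minus (V := R_NormedModule) f (fun _ => v)); [now apply Hc|apply continuous_const].
  - exists x; split; [exact Hx|lra].
Qed.

(** At height PI the imaginary part of c e^c is - PI e^x < 0, whereas that of s z is
    non-negative: the path cannot reach that line. *)
Lemma lambert_path_below_PI (omega : R -> C) (z : C) :
  (forall s, 0 <= s <= 1 -> Ccont omega s) -> omega 0 = RtoC 0 ->
  (forall s, 0 <= s <= 1 -> lambert (omega s) = (RtoC s * z)%C) ->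
  0 <= Im z -> Im (omega 1) < PI.
Proof.
  intros Hc H0 Hl Hz; apply Rnot_le_lt; intros H1.
  destruct (intermediate_value (fun s => Im (omega s)) 0 1 PI) as [s [Hs E]]; try lra.
  - intros s Hs; apply (proj1 (continuous_C_components _ _) (Hc s Hs)).
  - rewrite H0; simpl; apply PI_RGT_0.
  - assert (H := Im_lambert (omega s)); rewrite Hl, E, sin_PI, cos_PI in H by exact Hs.
    replace (Im (RtoC s * z)%C) with (s * Im z) in H by (unfold Im; simpl; ring).
    assert (He := exp_pos (Re (omega s))); assert (Hp := PI_RGT_0).
    assert (0 < exp (Re (omega s)) * PI) by now apply Rmult_lt_0_compat.
    assert (0 <= s * Im z) by (apply Rmult_le_pos; lra).
    lra.
Qed.

(** Near 0, c e^c is close to c; the radius 1/2 is enough as cos y > 1/2 there. *)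
Lemma Im_lambert_sign_small (c : C) : Rabs (Re c) < / 2 -> Rabs (Im c) < / 2 ->
  0 < Im (lambert c) -> 0 < Im c.
Proof.
  rewrite Im_lambert; set (x := Re c); set (y := Im c); intros Hx Hy H.
  apply Rabs_lt_between in Hx; apply Rabs_lt_between in Hy.
  assert (He := exp_pos x); apply Rnot_le_lt; intros H0.
  destruct (Req_dec y 0) as [E|n]; [rewrite E, sin_0 in H; lra|].
  assert (S1 : sin (- y) < - y) by (apply sin_lt_x; lra).
  assert (P := PI2_3_2).
  assert (S2 : 0 < sin (- y)) by (apply sin_gt_0; lra).
  rewrite sin_neg in *.
  assert (K : / 2 < cos y).
  { rewrite <- cos_neg; replace (/ 2) with (cos (PI / 3)) by (rewrite cos_PI3; field).
    apply cos_decreasing_1; lra. }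
  assert (x * sin y + y * cos y < 0) by nra.
  nra.
Qed.

(** The path starts upwards, and does not return to the real axis, where c e^c is
    real. *)
Lemma lambert_path_upper (omega : R -> C) (z : C) :
  (forall s, 0 <= s <= 1 -> Ccont omega s) -> omega 0 = RtoC 0 ->
  (forall s, 0 <= s <= 1 -> lambert (omega s) = (RtoC s * z)%C) ->
  0 < Im z -> 0 < Im (omega 1).
Proof.
  intros Hc H0 Hl Hz; apply Rnot_le_lt; intros H1.
  assert (Him : forall s, 0 <= s <= 1 -> Im (lambert (omega s)) = s * Im z).
  { intros s Hs; rewrite Hl by exact Hs; unfold Im; simpl; ring. }
  assert (Hd : locally 0 (fun s => Rabs (Re (omega s)) < / 2 /\ Rabs (Im (omega s)) < / 2)).
  { assert (Hh : 0 < / 2) by lra.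
    destruct (proj1 (continuous_C_components omega 0) (Hc 0 ltac:(lra))) as [C1 C2].
    assert (L1 := proj1 (filterlim_locally _ _) C1 (mkposreal _ Hh)).
    assert (L2 := proj1 (filterlim_locally _ _) C2 (mkposreal _ Hh)).
    generalize (filter_and _ _ L1 L2); apply filter_imp; intros s [B1 B2].
    rewrite H0 in B1, B2.
    change (Rabs (Re (omega s) - 0) < / 2) in B1; change (Rabs (Im (omega s) - 0) < / 2) in B2.
    rewrite Rminus_0_r in B1, B2; now split. }
  destruct Hd as [d Hd]; assert (Hd0 := cond_pos d).
  set (s := Rmin (d / 2) 1).
  assert (Hs : 0 < s <= 1) by (unfold s, Rmin; destruct Rle_dec; lra).
  assert (Hsd : s < d) by (unfold s, Rmin; destruct Rle_dec; lra).
  destruct (Hd s) as [B1 B2].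
  { change (Rabs (s - 0) < d); rewrite Rminus_0_r, Rabs_right; lra. }
  assert (Hy : 0 < Im (omega s)).
  { apply Im_lambert_sign_small; try assumption.
    rewrite Him by lra; apply Rmult_lt_0_compat; lra. }
  destruct (intermediate_value (fun s => - Im (omega s)) s 1 0) as [r [Hr E]]; try lra.
  - intros t Ht; apply (continuous_opp (V := R_NormedModule)).
    apply (proj1 (continuous_C_components _ _) (Hc t ltac:(lra))).
  - assert (E' : Im (omega r) = 0) by lra.
    assert (H := Him r ltac:(lra)); rewrite Im_lambert, E', sin_0, cos_0 in H.
    assert (0 < r * Im z) by (apply Rmult_lt_0_compat; lra). lra.
Qed.

Lemma lambert_path_in_region (omega : R -> C) (z : C) :
  (forall s, 0 <= s <= 1 -> Ccont omega s) -> omega 0 = RtoC 0 ->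
  (forall s, 0 <= s <= 1 -> lambert (omega s) = (RtoC s * z)%C) ->
  slit_plane 0 z -> principal_region (omega 1).
Proof.
  intros Hc H0 Hl Hz.
  assert (Hconj : forall s, 0 <= s <= 1 -> Ccont (fun s => Cconj (omega s)) s).
  { intros s Hs; destruct (proj1 (continuous_C_components omega s) (Hc s Hs)) as [C1 C2].
    apply continuous_C_components; split; simpl; [exact C1|].
    now apply (continuous_opp (V := R_NormedModule)). }
  assert (H0' : Cconj (omega 0) = RtoC 0).
  { rewrite H0; apply injective_projections; simpl; ring. }
  assert (Hl' : forall s, 0 <= s <= 1 -> lambert (Cconj (omega s)) = (RtoC s * Cconj z)%C).
  { intros s Hs; rewrite lambert_conj, Hl by exact Hs.
    apply injective_projections; simpl; ring. }
  assert (Hone : lambert (omega 1) = z) by (rewrite Hl, Cmult_1_l; [easy|lra]).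
  assert (Hup : forall (omega : R -> C) (z : C),
    (forall s, 0 <= s <= 1 -> Ccont omega s) -> omega 0 = RtoC 0 ->
    (forall s, 0 <= s <= 1 -> lambert (omega s) = (RtoC s * z)%C) ->
    0 < Im z -> principal_region (omega 1)).
  { clear; intros omega z Hc H0 Hl Hz.
    assert (H1 := lambert_path_below_PI omega z Hc H0 Hl (Rlt_le _ _ Hz)).
    assert (H2 := lambert_path_upper omega z Hc H0 Hl Hz).
    assert (H3 : Im (lambert (omega 1)) = Im z) by (rewrite Hl, Cmult_1_l; [easy|lra]).
    split; [lra|split].
    - apply (upper_region_Re_ge_m1 _ (Im (omega 1))); [lra|].
      rewrite Im_lambert in H3; assert (He := exp_pos (Re (omega 1))); nra.
    - rewrite H3; apply Rmult_le_pos; lra. }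
  destruct (Rtotal_order (Im z) 0) as [L|[L|L]].
  - rewrite <- (Cconj_conj (omega 1)); apply principal_region_conj.
    apply (Hup (fun s => Cconj (omega s)) (Cconj z)); try assumption.
    change (0 < - Im z); lra.
  - assert (U := lambert_path_below_PI omega z Hc H0 Hl ltac:(lra)).
    assert (V := lambert_path_below_PI _ _ Hconj H0' Hl' ltac:(change (0 <= - Im z); lra)).
    change (- Im (omega 1) < PI) in V.
    assert (Hre : 0 < Re z) by (apply Rnot_le_lt; intros H; apply Hz; now split).
    assert (Hy : Im (omega 1) = 0).
    { apply NNPP; intros Hy.
      assert (H := lambert_real_negative (omega 1) ltac:(lra) Hy); rewrite Hone in H; lra. }
    split; [lra|split; [|rewrite Hy; lra]].
    rewrite <- Hone, Re_lambert, Hy, sin_0, cos_0 in Hre.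
    assert (He := exp_pos (Re (omega 1))); nra.
  - now apply (Hup omega z).
Qed.

Lemma LambertW_in_region (W : C -> C) (z : C) :
  is_principal_LambertW W -> slit_plane 0 z ->
  lambert (W z) = z /\ principal_region (W z).
Proof.
  intros [HD [HE H0]] Hz.
  assert (He : -1 / exp 1 < 0).
  { assert (H := exp_pos 1); unfold Rdiv.
    assert (0 < / exp 1) by now apply Rinv_0_lt_compat. lra. }
  assert (Hs : forall s, 0 <= s <= 1 -> slit_plane (-1 / exp 1) (RtoC s * z)%C).
  { intros s Hs [H1 H2].
    replace (Im (RtoC s * z)%C) with (s * Im z) in H1 by (unfold Im; simpl; ring).
    replace (Re (RtoC s * z)%C) with (s * Re z) in H2 by (unfold Re; simpl; ring).
    destruct (Rmult_integral _ _ H1) as [E|E]; [rewrite E in H2; lra|].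
    apply Hz; split; [exact E|]; apply Rnot_lt_le; intros Hr; nra. }
  assert (Hone : (RtoC 1 * z)%C = z) by apply Cmult_1_l.
  split; [rewrite <- Hone at 1 2; apply HE, Hs; lra|].
  rewrite <- Hone; apply (lambert_path_in_region (fun s => W (RtoC s * z)%C) z); [| | |exact Hz].
  - intros s Hs'; apply (continuous_comp (fun s => (RtoC s * z)%C) W).
    + apply continuous_Cmult; [|apply continuous_const].
      apply continuous_RtoC, continuous_id.
    + assert (H := ex_derive_continuous (K := C_AbsRing) (V := C_NormedModule) W _ (HD _ (Hs s Hs'))).
      intros P HP; apply locally_C, H, HP.
  - now rewrite Cmult_0_l.
  - intros s Hs'; apply HE, Hs, Hs'.
Qed.

(** * The logarithm on the slit plane *)

(** The half-angle formula gives the argument on the whole slit plane by a single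
    smooth expression. *)
Definition slit_arg (u : C) : R := 2 * atan (Im u / (Re u + Cmod u)).
Definition slit_log (u : C) : C := (log_modulus (Re u) (Im u), slit_arg u).

Lemma slit_plane_Cmod (u : C) : slit_plane 0 u -> 0 < Cmod u /\ 0 < Re u + Cmod u.
Proof.
  intros H.
  assert (H0 : 0 < Cmod u).
  { apply Cmod_gt_0; intros E; apply H; rewrite E; simpl; lra. }
  split; [exact H0|].
  assert (H1 := Cmod2_alt u).
  apply Rnot_le_lt; intros Hle; apply H; split.
  - assert (Cmod u ^ 2 <= Re u ^ 2) by nra. nra.
  - lra.
Qed.

Lemma is_derive_slit_log (u : R -> C) (t : R) (du : C) :
  Cderiv u t du -> slit_plane 0 (u t) ->
  Cderiv (fun s => slit_log (u s)) t (du / u t)%C.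
Proof.
  intros Hu Hs; destruct (slit_plane_Cmod _ Hs) as [Hm Hp].
  assert (Hsq := Cmod2_alt (u t)).
  apply is_derive_C_components in Hu; apply is_derive_C_components.
  set (x := fun s : R => Re (u s)); set (y := fun s : R => Im (u s)).
  destruct Hu as [Hx Hy].
  change (is_derive x t (fst du)) in Hx; change (is_derive y t (snd du)) in Hy.
  set (r := fun s : R => sqrt (x s ^ 2 + y s ^ 2)).
  change (Cmod (u t)) with (r t) in *; change (Re (u t)) with (x t) in *;
    change (Im (u t)) with (y t) in *.
  assert (Hpos : 0 < x t ^ 2 + y t ^ 2) by nra.
  assert (Hr : is_derive r t ((x t * fst du + y t * snd du) / r t)).
  { unfold r; auto_derive.
    - repeat split; try (eexists; eassumption); simpl in Hpos; lra.
    - rewrite (is_derive_unique (fun s : R => x s) _ _ Hx),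
        (is_derive_unique (fun s : R => y s) _ _ Hy).
      unfold r in Hm; simpl in Hm |- *; field; lra. }
  replace (du / u t)%C with
    (((x t * fst du + y t * snd du) / r t ^ 2)%R,
     ((x t * snd du - y t * fst du) / r t ^ 2)%R) by
    (rewrite Hsq; apply injective_projections; simpl;
     change (fst (u t)) with (x t); change (snd (u t)) with (y t);
     simpl in Hpos; field; lra).
  split.
  - change (is_derive (fun s => ln (x s ^ 2 + y s ^ 2) / 2) t
      ((x t * fst du + y t * snd du) / r t ^ 2)).
    rewrite Hsq; auto_derive.
    + repeat split; try (eexists; eassumption); simpl in Hpos; lra.
    + rewrite (is_derive_unique (fun s : R => x s) _ _ Hx),
        (is_derive_unique (fun s : R => y s) _ _ Hy).
      simpl in Hpos |- *; field; lra.
  - change (is_derive (fun s => 2 * atan (y s / (x s + r s))) t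
      ((x t * snd du - y t * fst du) / r t ^ 2)).
    clearbody r; auto_derive.
    + repeat split; try (eexists; eassumption); lra.
    + rewrite (is_derive_unique (fun s : R => x s) _ _ Hx),
        (is_derive_unique (fun s : R => y s) _ _ Hy),
        (is_derive_unique (fun s : R => r s) _ _ Hr).
      assert (Hq : (x t + r t) ^ 2 + y t ^ 2 = 2 * r t * (x t + r t)) by
        (replace (y t ^ 2) with (r t ^ 2 - x t ^ 2) by lra; ring).
      assert (Hq' : 1 + y t * / (x t + r t) * (y t * / (x t + r t) * 1) = 2 * r t / (x t + r t)).
      { apply (Rmult_eq_reg_r ((x t + r t) ^ 2)); [|apply pow_nonzero; lra].
        field_simplify; lra. }
      simpl; rewrite Hq'.
      apply (Rmult_eq_reg_r (r t ^ 2 * (x t + r t))).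
      2:{ apply Rmult_integral_contrapositive; split; [apply pow_nonzero|]; lra. }
      field_simplify; [|lra|lra].
      replace (y t ^ 2) with (r t ^ 2 - x t ^ 2) by lra. ring.
Qed.

(** The two half-angle tangents are y / (|u| + x) and - y / (|u| - x), whose
    product is -1. *)
Lemma slit_log_opp_upper (u : C) : 0 < Im u ->
  (slit_log (- u) - slit_log u)%C = (0, - PI).
Proof.
  intros Hy.
  assert (Hs : slit_plane 0 u) by (intros [H _]; lra).
  assert (Hs' : slit_plane 0 (- u)) by (intros [H _]; unfold Im in *; simpl in H; lra).
  apply slit_plane_Cmod in Hs; apply slit_plane_Cmod in Hs'.
  rewrite Cmod_opp in Hs'; assert (Hsq := Cmod2_alt u).
  unfold slit_log, slit_arg, log_modulus; rewrite Cmod_opp.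
  change (Re (- u)) with (- Re u); change (Im (- u)) with (- Im u).
  apply injective_projections; simpl.
  - replace (- Re u * (- Re u * 1) + - Im u * (- Im u * 1)) with
      (Re u * (Re u * 1) + Im u * (Im u * 1)) by ring. ring.
  - change (- Re u) with (Re (- u)) at 1.
    set (m := Cmod u) in *; set (x := Re u) in *; set (y := Im u) in *.
    change (Re (- u)) with (- x) in *.
    replace (- y / (- x + m)) with (- / (y / (x + m))).
    + rewrite atan_opp, atan_inv by (apply Rdiv_lt_0_compat; lra). field.
    + replace (- x + m) with (y ^ 2 / (x + m)); [field; lra|].
      apply (Rmult_eq_reg_r (x + m)); [|lra]. field_simplify; lra.
Qed.
Lemma slit_log_opp_lower (u : C) : Im u < 0 ->
  (slit_log (- u) - slit_log u)%C = (0, PI).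
Proof.
  intros Hy.
  assert (H := slit_log_opp_upper (- u) ltac:(change (0 < - Im u); lra)).
  replace (- - u)%C with u in H by ring.
  replace (slit_log (- u) - slit_log u)%C with (- (slit_log u - slit_log (- u)))%C by ring.
  rewrite H; apply injective_projections; simpl; ring.
Qed.

Lemma is_CInt_log_derivative (u du : R -> C) (a b : R) : a <= b ->
  (forall t, a <= t <= b -> smooth_curve_at u du t) ->
  (forall t, a <= t <= b -> slit_plane 0 (u t)) ->
  is_CInt (fun t => (du t / u t)%C) a b (slit_log (u b) - slit_log (u a))%C.
Proof.
  intros Hab Hu Hs.
  apply (is_RInt_derive (V := C_R_CompleteNormedModule) (fun t => slit_log (u t)));
    rewrite Rmin_left, Rmax_right by assumption; intros t Ht.
  - apply is_derive_slit_log; [apply Hu, Ht|now apply Hs].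
  - destruct (Hu t Ht) as [H1 H2]; apply continuous_Cdiv; [exact H2| |].
    + eapply Cderiv_continuous; exact H1.
    + apply Cmod_gt_0, slit_plane_Cmod; now apply Hs.
Qed.

(** A logarithm of - u serves for curves that avoid the positive half-line. *)
Lemma is_CInt_log_derivative_opp (u du : R -> C) (a b : R) : a <= b ->
  (forall t, a <= t <= b -> smooth_curve_at u du t) ->
  (forall t, a <= t <= b -> slit_plane 0 (- u t)) ->
  is_CInt (fun t => (du t / u t)%C) a b (slit_log (- u b) - slit_log (- u a))%C.
Proof.
  intros Hab Hu Hs.
  apply (is_RInt_ext (V := C_R_NormedModule) (fun t => (- du t / - u t)%C)).
  { intros t; rewrite Rmin_left, Rmax_right by assumption; intros Ht.
    assert (H0 : (- u t)%C <> RtoC 0) by (apply Cmod_gt_0, slit_plane_Cmod, Hs; lra).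
    change (- du t / - u t = du t / u t)%C.
    field; intros E; apply H0; rewrite E; ring. }
  apply (is_CInt_log_derivative (fun t => - u t)%C (fun t => - du t)%C); try assumption.
  intros t Ht; destruct (Hu t Ht) as [H1 H2]; split.
  - exact (is_derive_opp (V := C_R_NormedModule) u t _ H1).
  - exact (continuous_opp (V := C_R_NormedModule) du t H2).
Qed.

(** * The kernel near its pole *)

Lemma continuous_C_id (c : C) : Ccont (fun c : C_UniformSpace => c) c.
Proof. apply continuous_id. Qed.

Lemma holomorphic_const (a c : C) : holomorphic_at (fun _ => a) (fun _ => RtoC 0) c.
Proof.
  split; [|split; apply continuous_const].
  intros p t dp _ _; eapply Cderiv_eq; [apply is_derive_Cconst|ring].
Qed.

Lemma holomorphic_id (c : C) : holomorphic_at (fun c => c) (fun _ => RtoC 1) c.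
Proof.
  split; [|split; [apply continuous_C_id|apply continuous_const]].
  intros p t dp _ Hp; eapply Cderiv_eq; [exact Hp|ring].
Qed.

Lemma holomorphic_plus (f g df dg : C -> C) (c : C) :
  holomorphic_at f df c -> holomorphic_at g dg c ->
  holomorphic_at (fun c => f c + g c)%C (fun c => df c + dg c)%C c.
Proof.
  intros [f1 [f2 f3]] [g1 [g2 g3]]; split; [|split; now apply continuous_Cplus].
  intros p t dp Hc Hp; eapply Cderiv_eq;
    [apply is_derive_Cplus; [exact (f1 p t dp Hc Hp)|exact (g1 p t dp Hc Hp)]|ring].
Qed.

Lemma holomorphic_mult (f g df dg : C -> C) (c : C) :
  holomorphic_at f df c -> holomorphic_at g dg c ->
  holomorphic_at (fun c => f c * g c)%C (fun c => df c * g c + f c * dg c)%C c.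
Proof.
  intros [f1 [f2 f3]] [g1 [g2 g3]]; split; [|split].
  - intros p t dp Hc Hp; eapply Cderiv_eq;
      [apply is_derive_Cmult; [exact (f1 p t dp Hc Hp)|exact (g1 p t dp Hc Hp)]|cbv beta; rewrite Hc; ring].
  - now apply continuous_Cmult.
  - apply continuous_Cplus; now apply continuous_Cmult.
Qed.

Lemma holomorphic_inv (f df : C -> C) (c : C) :
  holomorphic_at f df c -> f c <> RtoC 0 ->
  holomorphic_at (fun c => / f c)%C (fun c => - df c / (f c * f c))%C c.
Proof.
  intros [f1 [f2 f3]] H0; split; [|split].
  - intros p t dp Hc Hp; eapply Cderiv_eq.
    + apply (is_derive_Cinv (fun r => f (p r))); [exact (f1 p t dp Hc Hp)|now rewrite Hc].
    + cbv beta; rewrite Hc; field; exact H0.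
  - now apply continuous_Cinv.
  - apply continuous_Cdiv; [|now apply continuous_Cmult|now apply Cmult_neq_0].
    exact (continuous_opp (V := C_R_NormedModule) df c f3).
Qed.

Lemma holomorphic_Cexp (f df : C -> C) (c : C) :
  holomorphic_at f df c ->
  holomorphic_at (fun c => Cexp (f c)) (fun c => df c * Cexp (f c))%C c.
Proof.
  intros [f1 [f2 f3]]; split; [|split].
  - intros p t dp Hc Hp; eapply Cderiv_eq;
      [apply is_derive_Cexp; exact (f1 p t dp Hc Hp)|cbv beta; rewrite Hc; ring].
  - now apply continuous_Cexp.
  - apply continuous_Cmult; [exact f3|now apply continuous_Cexp].
Qed.

Lemma holomorphic_ext_loc (f g df : C -> C) (c : C) :
  locally (T := C_UniformSpace) c (fun c => f c = g c) ->
  holomorphic_at f df c -> holomorphic_at g df c.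
Proof.
  intros Hl [f1 [f2 f3]]; split; [|split; [|exact f3]].
  - intros p t dp Hc Hp; apply (is_derive_ext_loc (V := C_R_NormedModule) (fun r => f (p r))).
    + rewrite <- Hc in Hl; exact (Cderiv_continuous p t dp Hp _ Hl).
    + exact (f1 p t dp Hc Hp).
  - apply (continuous_ext_loc (U := C_UniformSpace) _ f); [|exact f2].
    exact Hl.
Qed.

Lemma Cexp_0 : Cexp (RtoC 0) = RtoC 1.
Proof.
  unfold Cexp; simpl; rewrite exp_0, cos_0, sin_0.
  apply injective_projections; simpl; ring.
Qed.

Lemma Cexp_plus (a b : C) : Cexp (a + b) = (Cexp a * Cexp b)%C.
Proof.
  unfold Cexp, Re, Im; simpl; rewrite exp_plus, cos_plus, sin_plus.
  apply injective_projections; simpl; ring.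
Qed.

Lemma Cexp_neq_0 (c : C) : Cexp c <> RtoC 0.
Proof.
  intros E; assert (H : (Cexp c * Cexp (- c) = RtoC 0)%C) by (rewrite E; ring).
  rewrite <- Cexp_plus in H; replace (c + - c)%C with (RtoC 0) in H by ring.
  rewrite Cexp_0 in H; injection H; lra.
Qed.

(** (e^c - 1) / c, continued at the removable singularity 0. *)
Definition expm1_quotient (c : C) : C :=
  if excluded_middle_informative (c = RtoC 0) then RtoC 1
  else ((Cexp c - 1) / c)%C.

Lemma expm1_quotient_0 : expm1_quotient (RtoC 0) = RtoC 1.
Proof.
  unfold expm1_quotient; destruct excluded_middle_informative; [easy|contradiction].
Qed.

Lemma expm1_quotient_mult (c : C) : (c * expm1_quotient c = Cexp c - 1)%C.
Proof.
  unfold expm1_quotient; destruct excluded_middle_informative as [->|H].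
  - rewrite Cexp_0; ring.
  - now field.
Qed.

Lemma holomorphic_expm1_quotient :
  exists d, forall b : C, b <> RtoC 0 -> holomorphic_at expm1_quotient d b.
Proof.
  eexists; intros b Hb.
  apply holomorphic_ext_loc with (fun c => (Cexp c + - RtoC 1) * / c)%C.
  - generalize (locally_Cneq_0 (fun c : C_UniformSpace => c) b (continuous_C_id b) Hb).
    apply filter_imp; intros d Hd; unfold expm1_quotient.
    destruct excluded_middle_informative; [contradiction|reflexivity].
  - apply holomorphic_mult.
    + apply holomorphic_plus; [|apply holomorphic_const].
      apply holomorphic_Cexp, holomorphic_id.
    + apply holomorphic_inv; [apply holomorphic_id|exact Hb].
Qed.

Lemma Cmod_CInt_le (f : R -> C) (a b M : R) (l : C) : a <= b ->
  (forall t, a <= t <= b -> Cmod (f t) <= M) -> is_CInt f a b l ->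
  Cmod l <= (b - a) * M.
Proof.
  intros Hab HM Hl; rewrite Cmod_norm.
  apply (norm_RInt_le_const (V := C_R_NormedModule) f a b l M); try assumption.
  intros t Ht; specialize (HM t Ht); rewrite Cmod_norm in HM; exact HM.
Qed.

Lemma continuous_Cmod_eps (f : C -> C) (c : C) :
  (forall eps : posreal, locally (T := C_UniformSpace) c
     (fun b => Cmod (f b - f c) < eps)) -> Ccont f c.
Proof.
  intros H; apply filterlim_locally; intros eps; generalize (H eps); apply filter_imp.
  intros b Hb; now apply C_NormedModule_mixin_compat1.
Qed.

Lemma continuous_Cmod_lt {T : UniformSpace} (f : T -> C) (x : T) (eps : R) : 0 < eps ->
  Ccont f x -> locally x (fun y => Cmod (f y - f x) < eps).
Proof.
  intros He Hf.
  assert (Hs : 0 < eps / sqrt 2) by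
    (apply Rdiv_lt_0_compat; [exact He|apply Rlt_sqrt2_0]).
  assert (H := proj1 (filterlim_locally f (f x)) Hf (mkposreal _ Hs)).
  revert H; apply filter_imp; intros t Ht.
  apply C_NormedModule_mixin_compat2 in Ht; simpl in Ht.
  replace (sqrt 2 * (eps / sqrt 2)) with eps in Ht.
  - exact Ht.
  - field; apply Rgt_not_eq, Rlt_sqrt2_0.
Qed.

(** This is what lets the contraction pass to the limit s -> 0. *)
Lemma continuous_expm1_quotient_0 : Ccont expm1_quotient (RtoC 0).
Proof.
  apply continuous_Cmod_eps; intros eps.
  assert (He := continuous_Cmod_lt (fun c : C_UniformSpace => Cexp c) (RtoC 0) (eps / 2)
    ltac:(assert (H := cond_pos eps); lra) (continuous_Cexp _ _ (continuous_C_id _))).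
  destruct He as [d Hd]; exists d; intros c Hc.
  rewrite expm1_quotient_0.
  destruct (classic (c = RtoC 0)) as [->|Hc0].
  { rewrite expm1_quotient_0; replace (RtoC 1 - RtoC 1)%C with (RtoC 0) by ring.
    rewrite Cmod_0; apply cond_pos. }
  (* the defect e^c - 1 - c is c times the mean of e^b - 1 for b in the segment
     from 0 to c, hence it is o(c) *)
  assert (HI : is_CInt (fun s => (c * (Cexp (RtoC s * c) - RtoC 1))%C) 0 1
    (Cexp c - RtoC 1 - c)%C).
  { replace (Cexp c - RtoC 1 - c)%C with (minus (G := C_R_NormedModule)
      (Cexp (RtoC 1 * c) - RtoC 1 * c)%C (Cexp (RtoC 0 * c) - RtoC 0 * c)%C).
    2:{ change ((Cexp (RtoC 1 * c) - RtoC 1 * c) - (Cexp (RtoC 0 * c) - RtoC 0 * c) =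
          Cexp c - RtoC 1 - c)%C.
        rewrite Cmult_1_l, Cmult_0_l, Cexp_0; ring. }
    assert (HR : forall s, Cderiv (fun s => (RtoC s * c)%C) s c).
    { intros s; eapply Cderiv_eq; [apply is_derive_Cmult|].
      - apply is_derive_RtoC.
      - apply is_derive_Cconst.
      - cbv beta. ring. }
    apply (is_RInt_derive (V := C_R_CompleteNormedModule)
      (fun s => (Cexp (RtoC s * c) - RtoC s * c)%C)).
    - intros s _; eapply Cderiv_eq.
      + apply (is_derive_minus (V := C_R_NormedModule)); [apply is_derive_Cexp|]; apply HR.
      + change (c * Cexp (RtoC s * c) - c = c * (Cexp (RtoC s * c) - RtoC 1))%C; ring.
    - intros s _; apply continuous_Cmult; [apply continuous_const|].
      apply continuous_Cminus; [|apply continuous_const].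
      apply continuous_Cexp; eapply Cderiv_continuous; apply HR. }
  assert (Hm : 0 < Cmod c) by now apply Cmod_gt_0.
  assert (HB : Cmod (Cexp c - RtoC 1 - c) <= (1 - 0) * (Cmod c * (eps / 2))).
  { apply (Cmod_CInt_le _ 0 1 _ _ ltac:(lra)) with (2 := HI).
    intros s Hs; rewrite Cmod_mult; apply Rmult_le_compat_l; [lra|].
    left; rewrite <- Cexp_0; apply Hd.
    destruct Hc as [H1 H2]; split; simpl in *.
    - change (Rabs ((s * fst c - 0 * snd c) - 0) < d).
      change (Rabs (fst c - 0) < d) in H1; rewrite Rminus_0_r in H1.
      replace (s * fst c - 0 * snd c - 0) with (s * fst c) by ring.
      rewrite Rabs_mult, (Rabs_right s) by lra.
      assert (H := Rabs_pos (fst c)); nra.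
    - change (Rabs ((s * snd c + 0 * fst c) - 0) < d).
      change (Rabs (snd c - 0) < d) in H2; rewrite Rminus_0_r in H2.
      replace (s * snd c + 0 * fst c - 0) with (s * snd c) by ring.
      rewrite Rabs_mult, (Rabs_right s) by lra.
      assert (H := Rabs_pos (snd c)); nra. }
  replace (expm1_quotient c - RtoC 1)%C with ((Cexp c - RtoC 1 - c) / c)%C.
  - rewrite Cmod_div by exact Hc0.
    apply Rle_lt_trans with (eps / 2); [|assert (H := cond_pos eps); lra].
    apply (Rmult_le_reg_r (Cmod c)); [exact Hm|].
    unfold Rdiv at 1; rewrite Rmult_assoc, Rinv_l by lra. lra.
  - rewrite <- expm1_quotient_mult; now field.
Qed.

(** (lambert (w + c) - lambert w) / c, written so that it makes sense at c = 0. *)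
Definition lambert_difference_quotient (w c : C) : C :=
  (Cexp w * (1 + (w + c) * expm1_quotient c))%C.

Lemma lambert_quotient_mult (w c : C) :
  (c * lambert_difference_quotient w c = lambert (w + c) - lambert w)%C.
Proof.
  unfold lambert_difference_quotient, lambert; rewrite Cexp_plus.
  replace (c * (Cexp w * (1 + (w + c) * expm1_quotient c)))%C with
    (Cexp w * (c + (w + c) * (c * expm1_quotient c)))%C by ring.
  rewrite expm1_quotient_mult; ring.
Qed.

(** This is c times the kernel (1 + b) / (lambert b - lambert w) at b = w + c; its
    value at c = 0 is the residue of the kernel at w. *)
Definition kernel_numerator (w c : C) : C :=
  ((1 + (w + c)) / lambert_difference_quotient w c)%C.

Lemma lambert_m1 : lambert (RtoC (-1)) = RtoC (- exp (-1)).
Proof.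
  unfold lambert, Cexp; simpl; rewrite cos_0, sin_0.
  apply injective_projections; simpl; ring.
Qed.

Lemma slit_lambert_neq_m1 (w : C) : slit_plane 0 (lambert w) -> (1 + w)%C <> RtoC 0.
Proof.
  intros H E; apply H; replace w with (RtoC (-1)).
  - rewrite lambert_m1; simpl; assert (He := exp_pos (-1)); lra.
  - replace w with (1 + w - 1)%C by ring; rewrite E.
    apply injective_projections; simpl; ring.
Qed.

Lemma kernel_numerator_0 (w : C) : (1 + w)%C <> RtoC 0 ->
  kernel_numerator w (RtoC 0) = (/ Cexp w)%C.
Proof.
  intros H; unfold kernel_numerator, lambert_difference_quotient; rewrite expm1_quotient_0.
  replace (w + RtoC 0)%C with w by ring.
  replace (1 + w * RtoC 1)%C with (1 + w)%C by ring.
  field; split; [apply Cexp_neq_0|exact H].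
Qed.

Lemma continuous_lambert_quotient (w c : C) : Ccont (lambert_difference_quotient w) c.
Proof.
  apply continuous_Cmult; [apply continuous_const|].
  apply continuous_Cplus; [apply continuous_const|].
  apply continuous_Cmult.
  - apply continuous_Cplus; [apply continuous_const|apply continuous_C_id].
  - destruct (classic (c = RtoC 0)) as [->|H]; [apply continuous_expm1_quotient_0|].
    destruct holomorphic_expm1_quotient as [d Hd]; apply (Hd c H).
Qed.

Lemma continuous_kernel_numerator_near_0 (w : C) : (1 + w)%C <> RtoC 0 ->
  locally (T := C_UniformSpace) (RtoC 0) (fun c => Ccont (kernel_numerator w) c).
Proof.
  intros H.
  assert (HL : locally (T := C_UniformSpace) (RtoC 0) (fun c => lambert_difference_quotient w c <> RtoC 0)).
  { apply locally_Cneq_0; [apply continuous_lambert_quotient|].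
    unfold lambert_difference_quotient; apply Cmult_neq_0; [apply Cexp_neq_0|].
    rewrite expm1_quotient_0.
    replace (1 + (w + RtoC 0) * RtoC 1)%C with (1 + w)%C by ring; exact H. }
  revert HL; apply filter_imp; intros c Hc; apply continuous_Cdiv; [| |exact Hc].
  - apply continuous_Cplus; [apply continuous_const|].
    apply continuous_Cplus; [apply continuous_const|apply continuous_C_id].
  - apply continuous_lambert_quotient.
Qed.

Lemma holomorphic_kernel_numerator (w : C) :
  exists d, forall c, c <> RtoC 0 -> lambert (w + c) <> lambert w ->
  locally (T := C_UniformSpace) c (holomorphic_at (kernel_numerator w) d).
Proof.
  destruct holomorphic_expm1_quotient as [dE HE].
  eexists; intros c Hc Hl.
  assert (Hq : lambert_difference_quotient w c <> RtoC 0).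
  { intros E; apply Hl; replace (lambert (w + c)) with
      (lambert w + (lambert (w + c) - lambert w))%C by ring.
    rewrite <- lambert_quotient_mult, E; ring. }
  generalize (filter_and _ _
    (locally_Cneq_0 (fun c : C_UniformSpace => c) c (continuous_C_id c) Hc)
    (locally_Cneq_0 (T := C_UniformSpace) (lambert_difference_quotient w) c (continuous_lambert_quotient w c) Hq)).
  apply filter_imp; intros b [Hb Hqb].
  apply holomorphic_mult.
  - apply holomorphic_plus; [apply holomorphic_const|].
    apply holomorphic_plus; [apply holomorphic_const|apply holomorphic_id].
  - apply holomorphic_inv; [|exact Hqb].
    apply holomorphic_mult; [apply holomorphic_const|].
    apply holomorphic_plus; [apply holomorphic_const|].
    apply holomorphic_mult; [|now apply HE].
    apply holomorphic_plus; [apply holomorphic_const|apply holomorphic_id].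
Qed.

(** * Contours around the pole *)

Definition kernel (z c : C) : C := ((1 + c) / (lambert c - z))%C.

Definition kernel_integral (z : C) (p dp : R -> C) (a b : R) : C :=
  CInt (fun t => (kernel z (p t) * dp t)%C) a b.

Definition log_integral (w : C) (p dp : R -> C) (a b : R) : C :=
  CInt (fun t => (dp t / (p t - w))%C) a b.

(** The curve may be contracted towards w: its points are in the principal region,
    which is what [segment_no_other_preimage] requires. *)
Definition admissible_curve (w : C) (p dp : R -> C) (a b : R) : Prop :=
  a <= b /\
  (forall t, a <= t <= b -> locally t (smooth_curve_at p dp)) /\
  (forall t, a <= t <= b -> principal_region (p t) /\ lambert (p t) <> lambert w).

Definition contracted_integral (w : C) (p dp : R -> C) (a b r : R) : C :=
  CInt (fun t => (kernel_numerator w (RtoC r * (p t - w)) * (dp t / (p t - w)))%C) a b.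

Lemma admissible_neq (w : C) (p dp : R -> C) (a b : R) (t : R) :
  admissible_curve w p dp a b -> a <= t <= b -> (p t - w)%C <> RtoC 0.
Proof.
  intros Hp Ht E; apply (proj2 (proj2 (proj2 Hp) t Ht)); f_equal.
  replace (p t) with (p t - w + w)%C by ring; rewrite E; ring.
Qed.

Lemma smooth_curve_translate (w : C) (p dp : R -> C) (t : R) :
  smooth_curve_at p dp t -> smooth_curve_at (fun t => p t - w)%C dp t.
Proof.
  intros [H1 H2]; split; [|exact H2].
  eapply Cderiv_eq;
    [apply (is_derive_minus (V := C_R_NormedModule)); [exact H1|apply is_derive_Cconst]|].
  change (dp t - RtoC 0 = dp t)%C; ring.
Qed.

Lemma admissible_smooth (w : C) (p dp : R -> C) (a b : R) (t : R) :
  admissible_curve w p dp a b -> a <= t <= b ->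
  locally t (smooth_curve_at (fun t => p t - w)%C dp).
Proof.
  intros Hp Ht; generalize (proj1 (proj2 Hp) t Ht); apply filter_imp.
  intros v; apply smooth_curve_translate.
Qed.

Lemma is_derive_contracted (w : C) (p dp : R -> C) (a b : R) (s : R) :
  slit_plane 0 (lambert w) -> principal_region w ->
  admissible_curve w p dp a b -> 0 < s <= 1 ->
  Cderiv (contracted_integral w p dp a b) s
    ((kernel_numerator w (RtoC s * (p b - w)) -
      kernel_numerator w (RtoC s * (p a - w))) / RtoC s)%C.
Proof.
  intros Hz Hw Hp Hs; destruct (holomorphic_kernel_numerator w) as [d Hd].
  apply (is_derive_contracted_integral (kernel_numerator w) d (fun t => p t - w)%C dp).
  - apply Hp.
  - lra.
  - intros t Ht; now apply (admissible_smooth w p dp a b).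
  - intros t Ht; now apply (admissible_neq w p dp a b).
  - intros t Ht.
    assert (H0 : (RtoC s * (p t - w))%C <> RtoC 0).
    { apply Cmult_neq_0; [|now apply (admissible_neq w p dp a b)].
      intros E; apply RtoC_inj in E; lra. }
    apply Hd; [exact H0|]; intros E; apply H0.
    apply (segment_no_other_preimage w (p t) s) in E; try assumption.
    + replace (RtoC s * (p t - w))%C with (w + RtoC s * (p t - w) - w)%C by ring.
      rewrite E; ring.
    + apply (proj2 (proj2 Hp) t Ht).
    + lra.
Qed.

Lemma continuous_contracted (w : C) (p dp : R -> C) (a b : R) :
  slit_plane 0 (lambert w) -> admissible_curve w p dp a b ->
  Ccont (contracted_integral w p dp a b) 0.
Proof.
  intros Hz Hp; apply (continuous_contracted_integral (kernel_numerator w) (fun t => p t - w)%C dp).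
  - apply Hp.
  - intros t Ht; now apply (admissible_smooth w p dp a b).
  - intros t Ht; now apply (admissible_neq w p dp a b).
  - apply continuous_kernel_numerator_near_0, slit_lambert_neq_m1, Hz.
Qed.

Lemma contracted_integral_1 (w : C) (p dp : R -> C) (a b : R) :
  admissible_curve w p dp a b ->
  contracted_integral w p dp a b 1 = kernel_integral (lambert w) p dp a b.
Proof.
  intros Hp; apply (RInt_ext (V := C_R_CompleteNormedModule)).
  assert (Hp' := Hp); destruct Hp' as [Hab [_ Hr]]; intros t; rewrite Rmin_left, Rmax_right by exact Hab.
  intros Ht; destruct (Hr t ltac:(lra)) as [_ Hl].
  assert (H0 := admissible_neq w p dp a b t Hp ltac:(lra)).
  assert (Hd : (lambert (p t) - lambert w)%C <> RtoC 0).
  { intros E; apply Hl; replace (lambert (p t)) with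
      (lambert (p t) - lambert w + lambert w)%C by ring; rewrite E; ring. }
  rewrite Cmult_1_l; unfold kernel, kernel_numerator.
  assert (Hm := lambert_quotient_mult w (p t - w)).
  replace (w + (p t - w))%C with (p t) in * by ring.
  rewrite <- Hm in Hd |- *.
  change ((1 + p t) / lambert_difference_quotient w (p t - w) * (dp t / (p t - w)) =
    (1 + p t) / ((p t - w) * lambert_difference_quotient w (p t - w)) * dp t)%C.
  field; split; [|exact H0].
  intros E; apply Hd; rewrite E; ring.
Qed.

Lemma contracted_integral_0 (w : C) (p dp : R -> C) (a b : R) :
  slit_plane 0 (lambert w) -> admissible_curve w p dp a b ->
  contracted_integral w p dp a b 0 = (/ Cexp w * log_integral w p dp a b)%C.
Proof.
  intros Hz Hp; assert (Hex : ex_CInt (fun t => (dp t / (p t - w))%C) a b).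
  { apply ex_CInt_continuous; [apply Hp|]; intros t Ht.
    destruct (locally_singleton _ _ (admissible_smooth w p dp a b t Hp Ht)) as [H1 H2].
    apply continuous_Cdiv; [exact H2| |now apply (admissible_neq w p dp a b)].
    eapply Cderiv_continuous; exact H1. }
  apply (is_RInt_unique (V := C_R_CompleteNormedModule)).
  apply (RInt_correct (V := C_R_CompleteNormedModule)) in Hex.
  fold (log_integral w p dp a b) in Hex.
  apply (is_RInt_ext (V := C_R_NormedModule) (fun t => (/ Cexp w * (dp t / (p t - w)))%C)).
  { intros t _; rewrite Cmult_0_l, (kernel_numerator_0 w (slit_lambert_neq_m1 w Hz)).
    reflexivity. }
  now apply is_CInt_Cmult_l.
Qed.

(** The four curves form a closed contour, the last two being traversed
    backwards: the derivatives of their contracted integrals add up to 0, so the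
    values at s = 1 and s = 0 agree. *)
Lemma contour_contraction (w : C) (p1 dp1 p2 dp2 p3 dp3 p4 dp4 : R -> C)
    (a1 b1 a2 b2 a3 b3 a4 b4 : R) :
  slit_plane 0 (lambert w) -> principal_region w ->
  admissible_curve w p1 dp1 a1 b1 -> admissible_curve w p2 dp2 a2 b2 ->
  admissible_curve w p3 dp3 a3 b3 -> admissible_curve w p4 dp4 a4 b4 ->
  p1 b1 = p2 a2 -> p2 b2 = p3 b3 -> p3 a3 = p4 b4 -> p4 a4 = p1 a1 ->
  let J := kernel_integral (lambert w) in
  let N := log_integral w in
  (J p1 dp1 a1 b1 + J p2 dp2 a2 b2 - J p3 dp3 a3 b3 - J p4 dp4 a4 b4 =
   / Cexp w * (N p1 dp1 a1 b1 + N p2 dp2 a2 b2 - N p3 dp3 a3 b3 - N p4 dp4 a4 b4))%C.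
Proof.
  intros Hz Hw H1 H2 H3 H4 E1 E2 E3 E4 J N; unfold J, N.
  pose (T := fun r => (contracted_integral w p1 dp1 a1 b1 r +
    contracted_integral w p2 dp2 a2 b2 r - contracted_integral w p3 dp3 a3 b3 r -
    contracted_integral w p4 dp4 a4 b4 r)%C).
  assert (HT : T 1 = T 0).
  { apply constant_of_zero_derivative.
    - intros s Hs; unfold T; eapply Cderiv_eq.
      + apply (is_derive_minus (V := C_R_NormedModule)).
        * apply (is_derive_minus (V := C_R_NormedModule)).
          -- apply is_derive_Cplus;
               [exact (is_derive_contracted w p1 dp1 a1 b1 s Hz Hw H1 Hs)
               |exact (is_derive_contracted w p2 dp2 a2 b2 s Hz Hw H2 Hs)].
          -- exact (is_derive_contracted w p3 dp3 a3 b3 s Hz Hw H3 Hs).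
        * exact (is_derive_contracted w p4 dp4 a4 b4 s Hz Hw H4 Hs).
      + rewrite E1, E2, E3, E4.
        match goal with |- ?l = ?r => change (l = r :> C) end.
        unfold minus, plus, opp; simpl.
        set (k := kernel_numerator w).
        change (((k (RtoC s * (p2 a2 - w)) - k (RtoC s * (p1 a1 - w))) / RtoC s +
          (k (RtoC s * (p3 b3 - w)) - k (RtoC s * (p2 a2 - w))) / RtoC s -
          (k (RtoC s * (p3 b3 - w)) - k (RtoC s * (p4 b4 - w))) / RtoC s -
          (k (RtoC s * (p4 b4 - w)) - k (RtoC s * (p1 a1 - w))) / RtoC s = 0)%C).
        unfold Cdiv; ring.
    - unfold T; apply continuous_Cminus; [apply continuous_Cminus; [apply continuous_Cplus|]|];
        now apply continuous_contracted. }
  unfold T in HT.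
  rewrite !contracted_integral_1, !contracted_integral_0 in HT by assumption.
  rewrite HT; ring.
Qed.

(** * The boundary curve of the principal region *)

(** Minus the point of the branch cut that corresponds to v. *)
Definition cut_value (v : R) : R := v * csc v * exp (- (v * cot v)).

Lemma cut_value_pos (v : R) : 0 < v < PI -> 0 < cut_value v.
Proof.
  intros Hv; assert (Hs : 0 < sin v) by (apply sin_gt_0; lra).
  unfold cut_value, csc.
  apply Rmult_lt_0_compat; [apply Rmult_lt_0_compat; [lra|]|apply exp_pos].
  now apply Rinv_0_lt_compat.
Qed.

Lemma slit_plane_add_neq_0 (z : C) (t : R) :
  slit_plane 0 z -> 0 < t -> (z + RtoC t)%C <> RtoC 0.
Proof.
  intros Hz Ht E; apply Hz; injection E; intros E2 E1; unfold Im, Re; lra.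
Qed.

(** The boundary value of the principal branch at - cut_value v, from above. *)
Definition cut_curve (v : R) : C := (- (v * cot v), v).
Definition cut_curve' (v : R) : C := (v * (/ sin v) ^ 2 - cot v, 1).

Lemma locally_0_PI (v : R) : 0 < v < PI -> locally v (fun x => 0 < x < PI).
Proof.
  intros Hv; apply (open_and (fun x => 0 < x) (fun x => x < PI)).
  - apply open_gt.
  - apply open_lt.
  - exact Hv.
Qed.

Lemma smooth_cut_curve (v : R) : 0 < v < PI -> smooth_curve_at cut_curve cut_curve' v.
Proof.
  intros Hv; assert (Hs : 0 < sin v) by (apply sin_gt_0; lra).
  assert (H3 := sin2_cos2 v); unfold Rsqr in H3.
  split.
  - apply is_derive_C_components; split; unfold cut_curve, cut_curve', cot; simpl.
    + auto_derive; [lra|].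
      replace (cos v * cos v) with (1 - sin v * sin v) by lra.
      field_simplify; [|lra|lra].
      replace (cos v ^ 2) with (1 - sin v ^ 2) by lra. field; lra.
    + apply (is_derive_id (K := R_AbsRing)).
  - apply continuous_C_components; split; unfold cut_curve', cot; simpl; [|apply continuous_const].
    apply (ex_derive_continuous (K := R_AbsRing) (V := R_NormedModule)
      (fun v => v * (/ sin v * (/ sin v * 1)) - cos v / sin v)).
    auto_derive; repeat split; lra.
Qed.

Lemma smooth_curve_conj (p dp : R -> C) (t : R) :
  smooth_curve_at p dp t ->
  smooth_curve_at (fun t => Cconj (p t)) (fun t => Cconj (dp t)) t.
Proof.
  intros [H1 H2]; split.
  - apply is_derive_C_components in H1; apply is_derive_C_components; split; simpl;
      [apply H1|apply (is_derive_opp (V := R_NormedModule)), H1].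
  - apply continuous_C_components in H2; apply continuous_C_components; split; simpl;
      [apply H2|apply (continuous_opp (V := R_NormedModule)), H2].
Qed.

Lemma Im_lambert_cut_curve (v : R) : 0 < v < PI -> Im (lambert (cut_curve v)) = 0.
Proof.
  intros Hv; assert (Hs : 0 < sin v) by (apply sin_gt_0; lra).
  rewrite Im_lambert; unfold cut_curve, cot, Re, Im; simpl.
  replace (- (v * (cos v / sin v)) * sin v + v * cos v) with 0 by (field; lra). ring.
Qed.

Lemma lambert_cut_curve (v : R) : 0 < v < PI ->
  lambert (cut_curve v) = RtoC (- cut_value v).
Proof.
  intros Hv; apply injective_projections; [|exact (Im_lambert_cut_curve v Hv)].
  change (Re (lambert (cut_curve v)) = - cut_value v).
  assert (Hs : 0 < sin v) by (apply sin_gt_0; lra).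
  rewrite Re_lambert; unfold cut_value, cut_curve, csc, cot, Re, Im; simpl.
  assert (H3 := sin2_cos2 v); unfold Rsqr in H3.
  replace (- (v * (cos v / sin v)) * cos v - v * sin v) with (- (v * / sin v)).
  - ring.
  - apply (Rmult_eq_reg_r (sin v)); [|lra]; field_simplify; [|lra|lra].
    replace (cos v ^ 2) with (1 - sin v ^ 2) by lra; ring.
Qed.

Lemma lambert_cut_curve_neq (z : C) (v : R) : slit_plane 0 z -> 0 < v < PI ->
  lambert (cut_curve v) <> z.
Proof.
  intros Hz Hv E; apply Hz; rewrite <- E, lambert_cut_curve by exact Hv.
  assert (Ht := cut_value_pos v Hv); split; simpl; lra.
Qed.

Lemma principal_region_cut_curve (v : R) : 0 < v < PI -> principal_region (cut_curve v).
Proof.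
  intros Hv; split; [unfold cut_curve, Im; simpl; lra|split].
  - unfold cut_curve, Re, cot; simpl.
    assert (Hs : 0 < sin v) by (apply sin_gt_0; lra).
    assert (H := cos_le_sin_over v ltac:(lra)).
    apply (Rmult_le_reg_r (sin v)); [exact Hs|].
    replace (- (v * (cos v / sin v)) * sin v) with (- (v * cos v)) by (field; lra). lra.
  - rewrite Im_lambert_cut_curve by exact Hv; lra.
Qed.

Lemma admissible_cut_curve (w : C) (a b : R) : 0 < a -> a <= b -> b < PI ->
  slit_plane 0 (lambert w) -> admissible_curve w cut_curve cut_curve' a b.
Proof.
  intros Ha Hab Hb Hz; split; [exact Hab|split; intros t Ht].
  - generalize (locally_0_PI t ltac:(lra)); apply filter_imp.
    intros v Hv; now apply smooth_cut_curve.
  - split; [apply principal_region_cut_curve; lra|].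
    apply lambert_cut_curve_neq; [exact Hz|lra].
Qed.

Lemma admissible_conj (w : C) (p dp : R -> C) (a b : R) :
  admissible_curve (Cconj w) p dp a b ->
  admissible_curve w (fun t => Cconj (p t)) (fun t => Cconj (dp t)) a b.
Proof.
  intros [Hab [H1 H2]]; split; [exact Hab|split; intros t Ht].
  - generalize (H1 t Ht); apply filter_imp; intros v; apply smooth_curve_conj.
  - destruct (H2 t Ht) as [H3 H4]; split; [now apply principal_region_conj|].
    intros E; apply H4; rewrite lambert_conj in E |- *; rewrite <- E.
    now rewrite Cconj_conj.
Qed.

Lemma slit_plane_conj (a : R) (z : C) : slit_plane a z -> slit_plane a (Cconj z).
Proof.
  intros H [H1 H2]; apply H; unfold Cconj, Re, Im in *; simpl in *; split; lra.
Qed.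

Definition vertical (x y : R) : C := (x, y).

Lemma smooth_vertical (x t : R) : smooth_curve_at (vertical x) (fun _ => Ci) t.
Proof.
  split; [|apply continuous_const].
  apply is_derive_C_components; split; simpl;
    [apply (is_derive_const (V := R_NormedModule))|apply (is_derive_id (K := R_AbsRing))].
Qed.

(** The vertical segment through the point at height v of the boundary curve stays
    in the region, because going vertically towards the real axis moves to the
    right of the homothetic point with centre -1. *)
Lemma principal_region_vertical (v y : R) : 0 < v < PI -> - v <= y <= v ->
  principal_region (vertical (- (v * cot v)) y).
Proof.
  intros Hv Hy.
  assert (Hc := principal_region_cut_curve v Hv).
  assert (Hx : -1 <= - (v * cot v)) by apply Hc.
  assert (Hpos : forall y, 0 < y <= v -> principal_region (vertical (- (v * cot v)) y)).
  { clear y Hy; intros y Hy; split; [unfold vertical, Im; simpl; lra|split; [exact Hx|]].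
    assert (H := upper_region_star_shaped (- (v * cot v)) v (y / v) (- (v * cot v)) Hv).
    replace (y / v * v) with y in H by (field; lra).
    rewrite Im_lambert; unfold vertical, Re, Im; simpl.
    assert (Hr : 0 < y / v <= 1).
    { split; [apply Rdiv_lt_0_compat; lra|].
      apply (Rmult_le_reg_r v); [lra|]; unfold Rdiv; rewrite Rmult_assoc, Rinv_l; lra. }
    assert (He := exp_pos (- (v * cot v))).
    repeat apply Rmult_le_pos; try lra; apply H; [|exact Hr|nra].
    right; unfold cot; field; apply Rgt_not_eq, sin_gt_0; lra. }
  destruct (Rtotal_order y 0) as [L|[->|L]].
  - rewrite <- (Cconj_conj (vertical _ y)); apply principal_region_conj.
    apply (Hpos (- y)); lra.
  - split; [unfold vertical, Im; simpl; lra|split; [exact Hx|]].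
    unfold vertical at 1; simpl; lra.
  - apply Hpos; lra.
Qed.

Lemma admissible_vertical (w : C) (v : R) : 0 < v < PI ->
  slit_plane 0 (lambert w) -> principal_region w -> - (v * cot v) <> Re w ->
  admissible_curve w (vertical (- (v * cot v))) (fun _ => Ci) (- v) v.
Proof.
  intros Hv Hz Hw Hne; split; [lra|split; intros t Ht].
  - apply filter_forall; intros x; apply smooth_vertical.
  - assert (Hr := principal_region_vertical v t Hv Ht); split; [exact Hr|].
    intros E; apply Hne.
    assert (H := segment_no_other_preimage w _ 1 Hz Hw Hr ltac:(lra)).
    simpl in H; rewrite Cmult_1_l in H.
    replace (w + (vertical (- (v * cot v)) t - w))%C with (vertical (- (v * cot v)) t) in H by ring.
    rewrite <- (H E); reflexivity.
Qed.

(** Here the slit matters: w is not on the boundary curve, where lambert takes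
    negative real values. *)
Lemma cut_curve_left (w : C) (v : R) : 0 < v < PI ->
  slit_plane 0 (lambert w) -> principal_region w ->
  Im w = v -> Re (cut_curve v) < Re w.
Proof.
  intros Hv Hz [_ [_ Him]] Hy.
  assert (Hs : 0 < sin v) by (apply sin_gt_0; lra).
  assert (Hi : 0 < Im (lambert w)).
  { destruct (Req_dec (Im (lambert w)) 0) as [E|n]; [|nra].
    exfalso; apply Hz; split; [exact E|left].
    apply lambert_real_negative; lra. }
  rewrite Im_lambert, Hy in Hi; assert (He := exp_pos (Re w)).
  assert (H : 0 < Re w * sin v + v * cos v) by nra.
  change (- (v * cot v) < Re w); unfold cot.
  apply (Rmult_lt_reg_r (sin v)); [exact Hs|].
  replace (- (v * (cos v / sin v)) * sin v) with (- (v * cos v)) by (field; lra). lra.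
Qed.

Lemma slit_principal_region_conj (w : C) : slit_plane 0 (lambert w) -> principal_region w ->
  slit_plane 0 (lambert (Cconj w)) /\ principal_region (Cconj w).
Proof.
  intros Hz Hw; split; [|now apply principal_region_conj].
  rewrite lambert_conj; now apply slit_plane_conj.
Qed.

Lemma principal_region_Re_gt_m1 (w : C) : slit_plane 0 (lambert w) -> principal_region w -> -1 < Re w.
Proof.
  intros Hz Hw.
  assert (Hup : forall w : C, slit_plane 0 (lambert w) -> principal_region w ->
    0 < Im w -> -1 < Re w).
  { clear; intros w Hz Hw Hy.
    assert (Hv : 0 < Im w < PI) by (destruct Hw; lra).
    apply Rle_lt_trans with (Re (cut_curve (Im w))).
    - now apply principal_region_cut_curve.
    - now apply cut_curve_left. }
  destruct (Rtotal_order (Im w) 0) as [L|[L|L]].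
  - destruct (slit_principal_region_conj w Hz Hw) as [H1 H2].
    apply (Hup _ H1 H2); change (0 < - Im w); lra.
  - destruct Hw as [_ [[H|H] _]]; [exact H|exfalso].
    apply (slit_lambert_neq_m1 w Hz); apply injective_projections; simpl;
      unfold Re, Im in *; lra.
  - now apply Hup.
Qed.

(** Seen from w, the left segment and the two arcs of the boundary curve avoid the
    half-line pointing right, and the right segment avoids the one pointing left.
    On the first three log(-u) is a primitive of du / u, on the last log u is;
    the two differ by - i PI at the upper right corner and by i PI at the lower
    one. The sign is negative as the contour runs clockwise. *)
Lemma winding_of_contour (w : C) (d V : R) :
  slit_plane 0 (lambert w) -> principal_region w ->
  0 < d -> d < V -> V < PI -> - (d * cot d) < Re w -> Re w < - (V * cot V) ->
  Rabs (Im w) < V ->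
  (log_integral w (vertical (- (d * cot d))) (fun _ => Ci) (- d) d +
   log_integral w cut_curve cut_curve' d V -
   log_integral w (vertical (- (V * cot V))) (fun _ => Ci) (- V) V -
   log_integral w (fun t => Cconj (cut_curve t)) (fun t => Cconj (cut_curve' t)) d V)%C
  = (0, - (2 * PI)).
Proof.
  intros Hz Hw Hd HdV HV Hxd HxV Hy; apply Rabs_lt_between in Hy.
  assert (Hleft : forall c : C, (Im c = Im w -> Re c < Re w) -> slit_plane 0 (- (c - w))%C).
  { intros c Hc [H1 H2].
    change (- (Im c + - Im w) = 0) in H1; change (- (Re c + - Re w) <= 0) in H2.
    assert (H := Hc ltac:(lra)); lra. }
  assert (HV1 := is_CInt_log_derivative_opp
    (fun t => vertical (- (d * cot d)) t - w)%C (fun _ => Ci) (- d) d ltac:(lra)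
    (fun t _ => smooth_curve_translate w _ _ t (smooth_vertical _ t))
    (fun t _ => Hleft (vertical (- (d * cot d)) t) (fun _ => Hxd))).
  assert (HP1 := is_CInt_log_derivative_opp
    (fun t => cut_curve t - w)%C cut_curve' d V ltac:(lra)
    (fun t Ht => smooth_curve_translate w _ _ t (smooth_cut_curve t ltac:(lra)))
    (fun t Ht => Hleft (cut_curve t) (fun E => cut_curve_left w t ltac:(lra) Hz Hw (eq_sym E)))).
  destruct (slit_principal_region_conj w Hz Hw) as [Hz' Hw'].
  assert (Hcj : forall t, d <= t <= V -> Im (Cconj (cut_curve t)) = Im w ->
    Re (Cconj (cut_curve t)) < Re w).
  { intros t Ht E; apply (cut_curve_left (Cconj w) t ltac:(lra) Hz' Hw').
    change (- t = Im w) in E; change (- Im w = t); lra. }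
  assert (HM1 := is_CInt_log_derivative_opp
    (fun t => Cconj (cut_curve t) - w)%C (fun t => Cconj (cut_curve' t)) d V ltac:(lra)
    (fun t Ht => smooth_curve_translate w _ _ t (smooth_curve_conj _ _ t (smooth_cut_curve t ltac:(lra))))
    (fun t Ht => Hleft _ (Hcj t Ht))).
  assert (HR1 : is_CInt (fun t => (Ci / (vertical (- (V * cot V)) t - w))%C) (- V) V
     (slit_log (vertical (- (V * cot V)) V - w) - slit_log (vertical (- (V * cot V)) (- V) - w))%C).
  { apply (is_CInt_log_derivative
      (fun t => vertical (- (V * cot V)) t - w)%C (fun _ => Ci) (- V) V ltac:(lra)
      (fun t _ => smooth_curve_translate w _ _ t (smooth_vertical _ t))).
    intros t _ [_ H2]; change (- (V * cot V) + - Re w <= 0) in H2; lra. }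
  unfold log_integral.
  rewrite (is_RInt_unique (V := C_R_CompleteNormedModule) _ _ _ _ HV1),
    (is_RInt_unique (V := C_R_CompleteNormedModule) _ _ _ _ HP1),
    (is_RInt_unique (V := C_R_CompleteNormedModule) _ _ _ _ HM1),
    (is_RInt_unique (V := C_R_CompleteNormedModule) _ _ _ _ HR1).
  change (vertical (- (d * cot d)) d) with (cut_curve d).
  change (vertical (- (d * cot d)) (- d)) with (Cconj (cut_curve d)).
  change (vertical (- (V * cot V)) V) with (cut_curve V).
  change (vertical (- (V * cot V)) (- V)) with (Cconj (cut_curve V)).
  assert (Hu := slit_log_opp_upper (cut_curve V - w)).
  assert (Hl := slit_log_opp_lower (Cconj (cut_curve V) - w)).
  specialize (Hu ltac:(change (0 < V + - Im w); lra)).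
  specialize (Hl ltac:(change (- V + - Im w < 0); lra)).
  transitivity ((slit_log (- (cut_curve V - w)) - slit_log (cut_curve V - w)) -
    (slit_log (- (Cconj (cut_curve V) - w)) - slit_log (Cconj (cut_curve V) - w)))%C; [ring|].
  rewrite Hu, Hl; apply injective_projections; simpl; ring.
Qed.

(** * The integral between two cuts *)

(** The denominators on the two conjugate arcs are the same real number minus z,
    so the numerators combine into 2 i Im ((1 + c) c'), which is 2 i times the
    numerator of the integrand. *)
Lemma integrand_as_kernel (z : C) (v : R) : slit_plane 0 z -> 0 < v < PI ->
  (kernel z (cut_curve v) * cut_curve' v -
   kernel z (Cconj (cut_curve v)) * Cconj (cut_curve' v) =
   - (2 * Ci) * LambertW_integrand z v)%C.
Proof.
  intros Hz Hv; unfold kernel; rewrite lambert_conj, lambert_cut_curve by exact Hv.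
  unfold LambertW_integrand; fold (cut_value v); set (t := cut_value v).
  replace (Cconj (RtoC (- t))) with (RtoC (- t)) by
    (apply injective_projections; simpl; ring).
  assert (H0 := slit_plane_add_neq_0 z t Hz (cut_value_pos v Hv)).
  replace (RtoC (- t) - z)%C with (- (z + RtoC t))%C by
    (rewrite RtoC_opp; ring).
  assert (Hn : ((1 + cut_curve v) * cut_curve' v -
      (1 + Cconj (cut_curve v)) * Cconj (cut_curve' v) =
      2 * Ci * RtoC (v ^ 2 + (1 - v * cot v) ^ 2))%C).
  { assert (Hs : 0 < sin v) by (apply sin_gt_0; lra).
    assert (H3 := sin2_cos2 v); unfold Rsqr in H3.
    assert (Hc : (/ sin v) ^ 2 = 1 + cot v ^ 2).
    { unfold cot; field_simplify; [|lra|lra].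
      replace (cos v ^ 2) with (1 - sin v ^ 2) by lra; field; lra. }
    unfold cut_curve, cut_curve'; rewrite Hc.
    apply injective_projections; simpl; ring. }
  transitivity (- (((1 + cut_curve v) * cut_curve' v -
      (1 + Cconj (cut_curve v)) * Cconj (cut_curve' v))) / (z + RtoC t))%C.
  - field; exact H0.
  - rewrite Hn; field; exact H0.
Qed.

Lemma continuous_integrand (z : C) (v : R) : slit_plane 0 z -> 0 < v < PI ->
  Ccont (LambertW_integrand z) v.
Proof.
  intros Hz Hv; assert (Hs : 0 < sin v) by (apply sin_gt_0; lra).
  apply continuous_Cdiv.
  - apply continuous_RtoC.
    apply (ex_derive_continuous (K := R_AbsRing) (V := R_NormedModule)).
    unfold cot; auto_derive; repeat split; lra.
  - apply continuous_Cplus; [apply continuous_const|apply continuous_RtoC].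
    apply (ex_derive_continuous (K := R_AbsRing) (V := R_NormedModule)
      (fun v => v * csc v * exp (- (v * cot v)))).
    unfold cot, csc; auto_derive; repeat split; lra.
  - exact (slit_plane_add_neq_0 z _ Hz (cut_value_pos v Hv)).
Qed.

Lemma continuous_lambert (c : C) : Ccont lambert c.
Proof.
  apply continuous_Cmult; [|apply continuous_Cexp]; apply continuous_C_id.
Qed.

Lemma continuous_kernel (z c : C) : lambert c <> z -> Ccont (kernel z) c.
Proof.
  intros H; apply continuous_Cdiv.
  - apply continuous_Cplus; [apply continuous_const|apply continuous_C_id].
  - apply continuous_Cminus; [apply continuous_lambert|apply continuous_const].
  - intros E; apply H; replace (lambert c) with (lambert c - z + z)%C by ring; rewrite E; ring.
Qed.

Lemma is_CInt_kernel (z : C) (p dp : R -> C) (a b : R) : a <= b ->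
  (forall t, a <= t <= b -> smooth_curve_at p dp t) ->
  (forall t, a <= t <= b -> lambert (p t) <> z) ->
  is_CInt (fun t => (kernel z (p t) * dp t)%C) a b (kernel_integral z p dp a b).
Proof.
  intros Hab Hp Hl; apply (RInt_correct (V := C_R_CompleteNormedModule)).
  apply ex_CInt_continuous; [exact Hab|]; intros t Ht; destruct (Hp t Ht) as [H1 H2].
  apply continuous_Cmult; [|exact H2].
  apply (continuous_comp p (kernel z)); [eapply Cderiv_continuous; exact H1|].
  now apply continuous_kernel, Hl.
Qed.

Lemma kernel_integral_cut_curves (z : C) (d V : R) : slit_plane 0 z ->
  0 < d -> d < V -> V < PI ->
  (kernel_integral z cut_curve cut_curve' d V -
   kernel_integral z (fun t => Cconj (cut_curve t)) (fun t => Cconj (cut_curve' t)) d V =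
   - (2 * Ci) * CInt (LambertW_integrand z) d V)%C.
Proof.
  intros Hz Hd HdV HV.
  assert (Hcut : forall z v, slit_plane 0 z -> d <= v <= V -> lambert (cut_curve v) <> z).
  { intros z' v Hz' Hv; apply lambert_cut_curve_neq; [exact Hz'|lra]. }
  assert (I1 := is_CInt_kernel z cut_curve cut_curve' d V ltac:(lra)
    (fun t Ht => smooth_cut_curve t ltac:(lra)) (fun t Ht => Hcut z t Hz Ht)).
  assert (I2 := is_CInt_kernel z (fun t => Cconj (cut_curve t)) (fun t => Cconj (cut_curve' t))
    d V ltac:(lra)
    (fun t Ht => smooth_curve_conj _ _ t (smooth_cut_curve t ltac:(lra)))).
  assert (I3 : ex_CInt (LambertW_integrand z) d V).
  { apply ex_CInt_continuous; [lra|]; intros t Ht; apply continuous_integrand; [exact Hz|lra]. }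
  apply (RInt_correct (V := C_R_CompleteNormedModule)) in I3.
  apply (is_CInt_Cmult_l (- (2 * Ci))) in I3.
  rewrite <- (is_RInt_unique (V := C_R_CompleteNormedModule) _ _ _ _ I3).
  symmetry; apply (is_RInt_unique (V := C_R_CompleteNormedModule)).
  assert (I4 := is_RInt_minus (V := C_R_NormedModule) _ _ _ _ _ _ I1
    (I2 (fun t Ht E => Hcut _ t (slit_plane_conj 0 z Hz) Ht
      (eq_trans (eq_sym (Cconj_conj _)) (f_equal Cconj (eq_trans (eq_sym (lambert_conj _)) E)))))).
  refine (is_RInt_ext (V := C_R_NormedModule) _ _ _ _ _ _ I4).
  intros t; rewrite Rmin_left, Rmax_right by lra; intros Ht.
  apply (integrand_as_kernel z t Hz); lra.
Qed.

Lemma truncated_integral (w : C) (d V : R) :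
  slit_plane 0 (lambert w) -> principal_region w ->
  0 < d -> d < V -> V < PI -> - (d * cot d) < Re w -> Re w < - (V * cot V) ->
  Rabs (Im w) < V ->
  let J v := kernel_integral (lambert w) (vertical (- (v * cot v))) (fun _ => Ci) (- v) v in
  (2 * Ci * (CInt (LambertW_integrand (lambert w)) d V - RtoC PI / Cexp w) = J d - J V)%C.
Proof.
  intros Hz Hw Hd HdV HV Hxd HxV Hy J.
  assert (HC := contour_contraction w (vertical (- (d * cot d))) (fun _ => Ci)
    cut_curve cut_curve' (vertical (- (V * cot V))) (fun _ => Ci)
    (fun t => Cconj (cut_curve t)) (fun t => Cconj (cut_curve' t))
    (- d) d d V (- V) V d V Hz Hw).
  assert (Hz' := slit_plane_conj 0 _ Hz); rewrite <- lambert_conj in Hz'.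
  specialize (HC (admissible_vertical w d ltac:(lra) Hz Hw ltac:(lra))
    (admissible_cut_curve w d V ltac:(lra) ltac:(lra) HV Hz)
    (admissible_vertical w V ltac:(lra) Hz Hw ltac:(lra))
    (admissible_conj w _ _ d V (admissible_cut_curve (Cconj w) d V ltac:(lra) ltac:(lra) HV Hz'))
    eq_refl eq_refl eq_refl eq_refl).
  cbv zeta in HC.
  rewrite (winding_of_contour w d V Hz Hw Hd HdV HV Hxd HxV Hy) in HC.
  assert (HK := kernel_integral_cut_curves (lambert w) d V Hz Hd HdV HV).
  fold (J d) (J V) in HC.
  set (A := kernel_integral (lambert w) cut_curve cut_curve' d V) in *.
  set (B := kernel_integral _ (fun t => Cconj (cut_curve t)) _ d V) in *.
  set (L := CInt (LambertW_integrand (lambert w)) d V) in *.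
  assert (E : (2 * Ci * L = B - A)%C).
  { replace (B - A)%C with (- (A - B))%C by ring; rewrite HK; ring. }
  replace (2 * Ci * (L - RtoC PI / Cexp w))%C with (2 * Ci * L - / Cexp w * (2 * Ci * RtoC PI))%C by
    (unfold Cdiv; ring).
  replace (2 * Ci * RtoC PI)%C with (- (0, - (2 * PI))%R)%C by
    (apply injective_projections; simpl; ring).
  rewrite E.
  replace (B - A - / Cexp w * - (0, - (2 * PI))%R)%C with
    (B - A + / Cexp w * (0, - (2 * PI))%R)%C by ring.
  rewrite <- HC; ring.
Qed.

(** * Estimates at both ends *)

Lemma slit_plane_distance (z : C) : slit_plane 0 z ->
  exists m, 0 < m /\ forall t, 0 <= t -> m <= Cmod (z + RtoC t).
Proof.
  intros Hz; destruct (Req_dec (Im z) 0) as [E|n].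
  - assert (Hr : 0 < Re z) by (apply Rnot_le_lt; intros H; now apply Hz).
    exists (Re z); split; [exact Hr|intros t Ht].
    assert (H := re_le_Cmod (z + RtoC t)).
    change (Re (z + RtoC t)) with (Re z + t)%R in H.
    rewrite Rabs_right in H; lra.
  - exists (Rabs (Im z)); split; [now apply Rabs_pos_lt|intros t Ht].
    assert (H := Rmax_Cmod (z + RtoC t)%C).
    change (snd (z + RtoC t)%C) with (Im z + 0)%R in H; rewrite Rplus_0_r in H.
    eapply Rle_trans; [apply Rmax_r|exact H].
Qed.

(** The upper bound follows from v cot v >= cos v and 1 - cos v <= v. *)
Lemma one_minus_v_cot_bounds (v : R) : 0 < v < 1 -> 0 <= 1 - v * cot v <= v.
Proof.
  intros Hv; assert (HP := PI2_3_2).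
  assert (Hs : 0 < sin v) by (apply sin_gt_0; lra).
  assert (Hc : 0 < cos v) by (apply cos_gt_0; lra).
  assert (E : v * cot v = v * cos v / sin v) by (unfold cot; field; lra).
  split.
  - assert (H := cos_le_sin_over v ltac:(lra)).
    assert (v * cos v / sin v <= 1).
    { apply (Rmult_le_reg_r (sin v)); [exact Hs|].
      unfold Rdiv; rewrite Rmult_assoc, Rinv_l; lra. }
    lra.
  - assert (H1 : sin v < v) by (apply sin_lt_x; lra).
    assert (H2 : cos v <= v * cos v / sin v).
    { apply (Rmult_le_reg_r (sin v)); [exact Hs|].
      unfold Rdiv; rewrite Rmult_assoc, Rinv_l; nra. }
    assert (H3 : 1 - cos v <= v).
    { replace v with (2 * (v / 2)) at 1 by field; rewrite cos_2a_sin.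
      assert (0 < sin (v / 2)) by (apply sin_gt_0; lra).
      assert (sin (v / 2) < v / 2) by (apply sin_lt_x; lra). nra. }
    lra.
Qed.

(** For v >= 2 PI / 3 one has v >= 2 and - cos v >= 1/2, while sin v <= PI - v. *)
Lemma cot_near_PI (v : R) : 2 * (PI / 3) <= v < PI -> / (PI - v) <= - (v * cot v).
Proof.
  intros Hv; assert (HP := PI2_3_2).
  assert (Hs : 0 < sin v) by (apply sin_gt_0; lra).
  assert (Hs' : sin v < PI - v).
  { rewrite <- sin_PI_x; apply sin_lt_x; lra. }
  assert (Hc : 1 / 2 <= - cos v).
  { rewrite <- cos_PI3.
    replace (- cos v) with (cos (PI - v)) by
      (rewrite cos_minus, cos_PI, sin_PI; ring).
    apply cos_decr_1; lra. }
  apply Rle_trans with (/ sin v); [now apply Rinv_le_contravar; [|left]|].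
  unfold cot; apply (Rmult_le_reg_r (sin v)); [exact Hs|].
  replace (- (v * (cos v / sin v)) * sin v) with (v * - cos v) by (field; lra).
  rewrite Rinv_l by lra; nra.
Qed.

Lemma Cmod_integrand (z : C) (v : R) : 0 < v < PI -> slit_plane 0 z ->
  Cmod (LambertW_integrand z v) = (v ^ 2 + (1 - v * cot v) ^ 2) /
    Cmod (z + RtoC (cut_value v)).
Proof.
  intros Hv Hz; unfold LambertW_integrand; rewrite Cmod_div.
  - rewrite Cmod_R, Rabs_right; [reflexivity|].
    apply Rle_ge; assert (H1 := pow2_ge_0 v); assert (H2 := pow2_ge_0 (1 - v * cot v)); lra.
  - exact (slit_plane_add_neq_0 z _ Hz (cut_value_pos v Hv)).
Qed.

Lemma integrand_near_0 (z : C) (m v : R) : slit_plane 0 z -> 0 < m ->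
  (forall t, 0 <= t -> m <= Cmod (z + RtoC t)) -> 0 < v < 1 ->
  Cmod (LambertW_integrand z v) <= 2 / m * v.
Proof.
  intros Hz Hm Hd Hv; assert (HP := PI2_3_2).
  rewrite Cmod_integrand by (try assumption; lra).
  assert (H := Hd _ (Rlt_le _ _ (cut_value_pos v ltac:(lra)))).
  assert (H1 := one_minus_v_cot_bounds v Hv).
  set (D := Cmod _) in *.
  assert (N : v ^ 2 + (1 - v * cot v) ^ 2 <= 2 * v) by nra.
  apply (Rmult_le_reg_r (m * D)); [apply Rmult_lt_0_compat; lra|].
  replace ((v ^ 2 + (1 - v * cot v) ^ 2) / D * (m * D)) with
    ((v ^ 2 + (1 - v * cot v) ^ 2) * m) by (field; lra).
  replace (2 / m * v * (m * D)) with (2 * v * D) by (field; lra).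
  nra.
Qed.

(** Cube of e^(x/3) >= x/3. *)
Lemma exp_ge_cube (x : R) : 0 <= x -> x ^ 3 / 27 <= exp x.
Proof.
  intros Hx; replace x with (x / 3 + x / 3 + x / 3) at 2 by field; rewrite !exp_plus.
  assert (H : x / 3 <= exp (x / 3)) by (assert (H := exp_ineq1_le (x / 3)); lra).
  set (y := x / 3) in *; replace (x ^ 3 / 27) with (y * y * y) by (unfold y; field).
  assert (0 <= y) by (unfold y; lra).
  apply Rmult_le_compat; try nra.
Qed.

(** With X = - v cot v >= 1 / (PI - v), the numerator is at most 2 X^2 and the
    denominator at least X^3 / 27 - |z| >= X^3 / 54; the hypothesis on v ensures
    that X is large enough for both bounds. *)
Lemma integrand_near_PI (z : C) (v : R) : slit_plane 0 z ->
  2 * (PI / 3) <= v < PI -> (PI - v) * (54 * Cmod z + 10) <= 1 ->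
  Cmod (LambertW_integrand z v) <= 108 * (PI - v).
Proof.
  intros Hz Hv Hc; assert (HP := PI2_3_2); assert (HP4 := PI_4).
  rewrite Cmod_integrand by (try assumption; lra).
  assert (Hx := cot_near_PI v Hv).
  assert (Hi : 54 * Cmod z + 10 <= / (PI - v)).
  { apply (Rmult_le_reg_l (PI - v)); [lra|]; rewrite Rinv_r; lra. }
  assert (Hz0 := Cmod_ge_0 z).
  assert (Hs : 0 < sin v <= 1) by (split; [apply sin_gt_0; lra|apply SIN_bound]).
  set (X := - (v * cot v)) in *.
  assert (HX : 54 * Cmod z + 10 <= X) by lra.
  change (cut_value v) with (v * csc v * exp X).
  replace (v * cot v) with (- X) by (unfold X; ring).
  set (t := v * csc v * exp X).
  assert (Ht : X ^ 3 / 27 <= t).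
  { apply Rle_trans with (exp X); [apply exp_ge_cube; lra|].
    assert (Hvs : 1 <= v * csc v).
    { unfold csc; apply (Rmult_le_reg_r (sin v)); [lra|].
      rewrite Rmult_assoc, Rinv_l; lra. }
    assert (H := exp_pos X); unfold t; nra. }
  assert (HD : X ^ 3 / 54 <= Cmod (z + RtoC t)).
  { assert (H := Cmod_triangle (z + RtoC t) (- z)).
    replace (z + RtoC t + - z)%C with (RtoC t) in H by ring.
    rewrite Cmod_opp, Cmod_R in H.
    assert (H1 := Rle_abs t).
    assert (H2 : X <= X ^ 3) by (assert (1 <= X) by lra; nra).
    lra. }
  assert (HX3 : 0 < X ^ 3) by (apply pow_lt; lra).
  set (D := Cmod (z + RtoC t)) in *.
  apply Rle_trans with (108 / X).
  - apply (Rmult_le_reg_r (D * X)); [apply Rmult_lt_0_compat; lra|].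
    replace ((v ^ 2 + (1 - - X) ^ 2) / D * (D * X)) with ((v ^ 2 + (1 - - X) ^ 2) * X) by (field; lra).
    replace (108 / X * (D * X)) with (108 * D) by (field; lra).
    assert (N : v ^ 2 + (1 - - X) ^ 2 <= 2 * X ^ 2) by nra.
    apply Rle_trans with (2 * X ^ 2 * X); [apply Rmult_le_compat_r; lra|]. simpl in *; lra.
  - unfold Rdiv; apply Rmult_le_compat_l; [lra|].
    rewrite <- (Rinv_inv (PI - v)); apply Rinv_le_contravar; [|exact Hx].
    apply Rinv_0_lt_compat; lra.
Qed.

Lemma Cmod_le_abs (c : C) : Cmod c <= Rabs (Re c) + Rabs (Im c).
Proof.
  assert (H := Cmod2_alt c); assert (H0 := Cmod_ge_0 c).
  assert (H1 := Rabs_pos (Re c)); assert (H2 := Rabs_pos (Im c)).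
  rewrite <- (pow2_abs (Re c)), <- (pow2_abs (Im c)) in H. nra.
Qed.

Lemma Cmod_Cexp (c : C) : Cmod (Cexp c) = exp (Re c).
Proof.
  assert (H := Cmod2_alt (Cexp c)); assert (H0 := Cmod_ge_0 (Cexp c)).
  assert (He := exp_pos (Re c)); assert (H1 := sin2_cos2 (Im c)); unfold Rsqr in H1.
  change (Re (Cexp c)) with (exp (Re c) * cos (Im c)) in H.
  change (Im (Cexp c)) with (exp (Re c) * sin (Im c)) in H.
  replace ((exp (Re c) * cos (Im c)) ^ 2 + (exp (Re c) * sin (Im c)) ^ 2) with
    (exp (Re c) ^ 2 * (sin (Im c) * sin (Im c) + cos (Im c) * cos (Im c))) in H by ring.
  rewrite H1 in H; nra.
Qed.

(** Here |1 + c| <= 2 X, and |lambert c| >= X e^X >= X^2 + X. *)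
Lemma kernel_far_right (z c : C) : - PI <= Im c <= PI -> Cmod z + 5 <= Re c ->
  Cmod (kernel z c) <= 2 / Re c.
Proof.
  intros Hy Hx; assert (HP4 := PI_4); assert (Hz0 := Cmod_ge_0 z).
  set (X := Re c) in *.
  assert (HN : Cmod (1 + c) <= 2 * X).
  { eapply Rle_trans; [apply Cmod_le_abs|].
    change (Re (1 + c)) with (1 + X)%R; change (Im (1 + c)) with (0 + Im c)%R.
    rewrite (Rabs_right (1 + X)), Rplus_0_l by lra.
    assert (H : Rabs (Im c) <= 4) by (apply Rabs_le; lra). lra. }
  assert (HL : X ^ 2 + X <= Cmod (lambert c)).
  { unfold lambert; rewrite Cmod_mult, Cmod_Cexp; fold X.
    assert (H1 := re_le_Cmod c); fold X in H1; rewrite Rabs_right in H1 by lra.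
    assert (H2 := exp_ineq1_le X); nra. }
  assert (HD : X ^ 2 <= Cmod (lambert c - z)).
  { assert (H := Cmod_triangle (lambert c - z) z).
    replace (lambert c - z + z)%C with (lambert c) in H by ring. lra. }
  assert (H2 : 0 < X ^ 2) by (apply pow_lt; lra).
  unfold kernel; rewrite Cmod_div.
  - apply (Rmult_le_reg_r (Cmod (lambert c - z) * X)); [apply Rmult_lt_0_compat; lra|].
    replace (Cmod (1 + c) / Cmod (lambert c - z) * (Cmod (lambert c - z) * X)) with
      (Cmod (1 + c) * X) by (field; lra).
    replace (2 / X * (Cmod (lambert c - z) * X)) with (2 * Cmod (lambert c - z)) by (field; lra).
    nra.
  - intros E; rewrite E, Cmod_0 in HD; lra.
Qed.

Lemma kernel_integral_far_right (w : C) (V : R) :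
  slit_plane 0 (lambert w) -> principal_region w ->
  2 * (PI / 3) <= V < PI -> Re w < - (V * cot V) ->
  Cmod (lambert w) + 5 <= - (V * cot V) ->
  Cmod (kernel_integral (lambert w) (vertical (- (V * cot V))) (fun _ => Ci) (- V) V)
    <= 16 * (PI - V).
Proof.
  intros Hz Hw HV Hx Hb; assert (HP := PI2_3_2); assert (HP4 := PI_4).
  assert (HA := admissible_vertical w V ltac:(lra) Hz Hw ltac:(lra)).
  set (X := - (V * cot V)) in *.
  assert (HI := is_CInt_kernel (lambert w) (vertical X) (fun _ => Ci) (- V) V ltac:(lra)
    (fun t _ => smooth_vertical X t) (fun t Ht => proj2 (proj2 (proj2 HA) t Ht))).
  assert (Hz0 := Cmod_ge_0 (lambert w)).
  eapply Rle_trans; [apply (Cmod_CInt_le _ (- V) V (2 / X) _ ltac:(lra)) with (2 := HI)|].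
  - intros t Ht; rewrite Cmod_mult, Cmod_Ci, Rmult_1_r.
    apply (kernel_far_right (lambert w) (vertical X t)); unfold vertical, Re, Im; simpl; lra.
  - assert (H := cot_near_PI V HV); fold X in H.
    assert (/ X <= PI - V).
    { rewrite <- (Rinv_inv (PI - V)); apply Rinv_le_contravar; [|exact H].
      apply Rinv_0_lt_compat; lra. }
    assert (0 < / X) by (apply Rinv_0_lt_compat; lra).
    unfold Rdiv; nra.
Qed.

(** The left segment shrinks to the point -1, where the kernel is continuous. *)
Lemma kernel_integral_near_m1 (w : C) :
  slit_plane 0 (lambert w) -> principal_region w ->
  exists M rho, 0 <= M /\ 0 < rho /\ forall d, 0 < d < rho ->
  Cmod (kernel_integral (lambert w) (vertical (- (d * cot d))) (fun _ => Ci) (- d) d)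
    <= M * d.
Proof.
  intros Hz Hw; assert (HP := PI2_3_2).
  assert (H1 : lambert (RtoC (-1)) <> lambert w).
  { intros E; apply Hz; rewrite <- E, lambert_m1; simpl; assert (He := exp_pos (-1)); lra. }
  destruct (continuous_Cmod_lt (kernel (lambert w)) (RtoC (-1)) 1 Rlt_0_1
    (continuous_kernel _ _ H1)) as [r Hr].
  assert (Hw1 := principal_region_Re_gt_m1 w Hz Hw).
  set (k0 := kernel (lambert w) (RtoC (-1))) in *.
  assert (Hk0 := Cmod_ge_0 k0); assert (Hr0 := cond_pos r).
  exists (2 * (Cmod k0 + 1)), (Rmin 1 (Rmin r (1 + Re w))); split; [lra|split].
  { repeat apply Rmin_case; lra. }
  intros d [Hd0 Hd].
  assert (Hd1 : d < 1) by (eapply Rlt_le_trans; [exact Hd|apply Rmin_l]).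
  assert (Hdr : d < r /\ d < 1 + Re w).
  { assert (d < Rmin r (1 + Re w)) by (eapply Rlt_le_trans; [exact Hd|apply Rmin_r]).
    split; (eapply Rlt_le_trans; [eassumption|]); [apply Rmin_l|apply Rmin_r]. }
  assert (Hb := one_minus_v_cot_bounds d ltac:(lra)).
  assert (HA := admissible_vertical w d ltac:(lra) Hz Hw ltac:(lra)).
  set (X := - (d * cot d)) in *.
  assert (HI := is_CInt_kernel (lambert w) (vertical X) (fun _ => Ci) (- d) d ltac:(lra)
    (fun t _ => smooth_vertical X t) (fun t Ht => proj2 (proj2 (proj2 HA) t Ht))).
  eapply Rle_trans; [apply (Cmod_CInt_le _ (- d) d (Cmod k0 + 1) _ ltac:(lra)) with (2 := HI)|].
  - intros t Ht; rewrite Cmod_mult, Cmod_Ci, Rmult_1_r.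
    assert (Hk : Cmod (kernel (lambert w) (vertical X t) - k0) < 1).
    { apply Hr; split; simpl.
      - change (Rabs (X - -1) < r); unfold X in *; apply Rabs_def1; lra.
      - change (Rabs (t - 0) < r); apply Rabs_def1; lra. }
    assert (H := Cmod_triangle (kernel (lambert w) (vertical X t) - k0) k0).
    replace (kernel (lambert w) (vertical X t) - k0 + k0)%C with
      (kernel (lambert w) (vertical X t)) in H by ring. lra.
  - lra.
Qed.

(** The values at the end points are the limits of the integrand, which makes it
    continuous on [0, PI]. *)
Definition extended_integrand (z : C) (v : R) : C :=
  if Rlt_dec 0 v then if Rlt_dec v PI then LambertW_integrand z v else RtoC 0
  else RtoC 0.

Lemma extended_integrand_eq (z : C) (v : R) : 0 < v < PI ->
  extended_integrand z v = LambertW_integrand z v.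
Proof.
  intros Hv; unfold extended_integrand; destruct (Rlt_dec 0 v), (Rlt_dec v PI); lra || reflexivity.
Qed.

Lemma continuous_extended_integrand (z : C) (v : R) : slit_plane 0 z ->
  0 <= v <= PI -> Ccont (extended_integrand z) v.
Proof.
  intros Hz Hv; assert (HP := PI2_3_2).
  assert (Hlin : forall (x K r : R), 0 < K -> 0 < r -> extended_integrand z x = RtoC 0 ->
    (forall v, Rabs (v - x) < r -> Cmod (extended_integrand z v) <= K * Rabs (v - x)) ->
    Ccont (extended_integrand z) x).
  { intros x K r HK Hr E HL; apply filterlim_locally; intros eps.
    assert (He : 0 < Rmin r (eps / K)).
    { apply Rmin_case; [exact Hr|apply Rdiv_lt_0_compat; [apply cond_pos|exact HK]]. }
    exists (mkposreal _ He); intros y Hy; change (Rabs (y - x) < Rmin r (eps / K)) in Hy.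
    apply C_NormedModule_mixin_compat1; rewrite E.
    change (Cmod (extended_integrand z y - RtoC 0) < eps).
    replace (extended_integrand z y - RtoC 0)%C with (extended_integrand z y) by ring.
    eapply Rle_lt_trans; [apply HL; eapply Rlt_le_trans; [exact Hy|apply Rmin_l]|].
    assert (H : Rabs (y - x) < eps / K) by (eapply Rlt_le_trans; [exact Hy|apply Rmin_r]).
    apply (Rmult_lt_compat_l K) in H; [|exact HK].
    replace (K * (eps / K)) with (pos eps) in H by (field; lra). exact H. }
  destruct (Req_dec v 0) as [->|n0]; [|destruct (Req_dec v PI) as [->|n1]].
  - destruct (slit_plane_distance z Hz) as [m [Hm Hd]].
    apply (Hlin 0 (2 / m) 1).
    + apply Rdiv_lt_0_compat; lra.
    + lra.
    + unfold extended_integrand; destruct Rlt_dec; [lra|reflexivity].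
    + intros v Hv'; rewrite Rminus_0_r in *; apply Rabs_lt_between in Hv'.
      destruct (Rlt_dec 0 v) as [L|L].
      * rewrite extended_integrand_eq, (Rabs_right v) by lra.
        apply integrand_near_0; try assumption; lra.
      * unfold extended_integrand; destruct Rlt_dec; [lra|].
        rewrite Cmod_0; apply Rmult_le_pos; [|apply Rabs_pos].
        left; apply Rdiv_lt_0_compat; lra.
  - assert (Hz0 := Cmod_ge_0 z).
    apply (Hlin PI 108 (/ (54 * Cmod z + 10))).
    + lra.
    + apply Rinv_0_lt_compat; lra.
    + unfold extended_integrand; destruct Rlt_dec; [|reflexivity].
      destruct Rlt_dec; [lra|reflexivity].
    + intros v Hv'.
      assert (Hi : / (54 * Cmod z + 10) <= / 10) by (apply Rinv_le_contravar; lra).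
      destruct (Rlt_dec v PI) as [L|L].
      * rewrite Rabs_left in * by lra.
        rewrite extended_integrand_eq by lra.
        replace (- (v - PI)) with (PI - v) in * by ring.
        apply integrand_near_PI; [exact Hz|lra|].
        apply (Rmult_lt_compat_r (54 * Cmod z + 10)) in Hv'; [|lra].
        rewrite Rinv_l in Hv' by lra; lra.
      * unfold extended_integrand; destruct Rlt_dec as [L'|L'].
        -- destruct Rlt_dec; [lra|]; rewrite Cmod_0; assert (H := Rabs_pos (v - PI)); lra.
        -- rewrite Cmod_0; assert (H := Rabs_pos (v - PI)); lra.
  - apply (continuous_ext_loc (U := C_UniformSpace) _ (LambertW_integrand z)).
    + generalize (locally_0_PI v ltac:(lra)); apply filter_imp; intros x Hx.
      symmetry; now apply extended_integrand_eq.
    + apply continuous_integrand; [exact Hz|lra].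
Qed.

(** * Letting the cuts tend to the end points *)

Lemma lt_Rmin (x a b : R) : x < Rmin a b -> x < a /\ x < b.
Proof.
  intros H; split; eapply Rlt_le_trans; try exact H; [apply Rmin_l|apply Rmin_r].
Qed.

Lemma ex_CInt_integrand (z : C) : slit_plane 0 z ->
  ex_CInt (LambertW_integrand z) 0 PI /\
  CInt (LambertW_integrand z) 0 PI = CInt (extended_integrand z) 0 PI.
Proof.
  intros Hz; assert (HP := PI_RGT_0).
  assert (E : forall v, Rmin 0 PI < v < Rmax 0 PI ->
    extended_integrand z v = LambertW_integrand z v).
  { intros v; rewrite Rmin_left, Rmax_right by lra; apply extended_integrand_eq. }
  split.
  - apply (ex_RInt_ext (V := C_R_NormedModule) (extended_integrand z)); [exact E|].
    apply ex_CInt_continuous; [lra|]; intros v Hv; now apply continuous_extended_integrand.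
  - symmetry; apply (RInt_ext (V := C_R_CompleteNormedModule)); exact E.
Qed.

Lemma integral_end_pieces (z : C) : slit_plane 0 z ->
  exists K eta0, 0 <= K /\ 0 < eta0 < 1 /\ forall eta, 0 < eta < eta0 ->
  Cmod (CInt (LambertW_integrand z) 0 PI -
        CInt (LambertW_integrand z) eta (PI - eta)) <= K * eta.
Proof.
  intros Hz; assert (HP := PI2_3_2).
  destruct (slit_plane_distance z Hz) as [m [Hm Hd]].
  assert (Hz0 := Cmod_ge_0 z).
  assert (Hm2 : 0 < 2 / m) by (apply Rdiv_lt_0_compat; lra).
  exists (2 / m + 108), (/ (54 * Cmod z + 10)); split; [lra|split].
  { split; [apply Rinv_0_lt_compat; lra|].
    rewrite <- Rinv_1; apply Rinv_lt_contravar; lra. }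
  intros eta [He0 He].
  assert (He1 : eta < 1 / 10).
  { eapply Rlt_le_trans; [exact He|]; unfold Rdiv; rewrite Rmult_1_l.
    apply Rinv_le_contravar; lra. }
  assert (HeK : eta * (54 * Cmod z + 10) <= 1).
  { apply (Rmult_lt_compat_r (54 * Cmod z + 10)) in He; [|lra].
    rewrite Rinv_l in He; lra. }
  rewrite (proj2 (ex_CInt_integrand z Hz)).
  set (g := extended_integrand z).
  assert (Hg : forall a b, 0 <= a -> a <= b -> b <= PI -> is_CInt g a b (CInt g a b)).
  { intros a b Ha Hab Hb; apply (RInt_correct (V := C_R_CompleteNormedModule)).
    apply ex_CInt_continuous; [exact Hab|]; intros v Hv.
    apply continuous_extended_integrand; [exact Hz|lra]. }
  replace (CInt (LambertW_integrand z) eta (PI - eta)) with (CInt g eta (PI - eta)).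
  2:{ apply (RInt_ext (V := C_R_CompleteNormedModule)); intros v.
      rewrite Rmin_left, Rmax_right by lra; intros Hv.
      apply extended_integrand_eq; lra. }
  assert (HCh : CInt g 0 PI = (CInt g 0 eta + (CInt g eta (PI - eta) + CInt g (PI - eta) PI))%C).
  { apply (is_RInt_unique (V := C_R_CompleteNormedModule)).
    apply (is_RInt_Chasles (V := C_R_NormedModule) g 0 eta PI); [apply Hg; lra|].
    apply (is_RInt_Chasles (V := C_R_NormedModule) g eta (PI - eta) PI); apply Hg; lra. }
  rewrite HCh.
  replace (CInt g 0 eta + (CInt g eta (PI - eta) + CInt g (PI - eta) PI) - CInt g eta (PI - eta))%C
    with (CInt g 0 eta + CInt g (PI - eta) PI)%C by ring.
  eapply Rle_trans; [apply Cmod_triangle|].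
  assert (H1 : Cmod (CInt g 0 eta) <= (eta - 0) * (2 / m)).
  { apply (Cmod_CInt_le g 0 eta _ _ ltac:(lra)) with (2 := Hg 0 eta ltac:(lra) ltac:(lra) ltac:(lra)).
    intros v Hv; unfold g; destruct (Req_dec v 0) as [->|n].
    - unfold extended_integrand; destruct Rlt_dec; [lra|rewrite Cmod_0; lra].
    - rewrite extended_integrand_eq by lra.
      eapply Rle_trans; [apply (integrand_near_0 z m); try assumption; lra|].
      rewrite <- (Rmult_1_r (2 / m)) at 2; apply Rmult_le_compat_l; lra. }
  assert (H2 : Cmod (CInt g (PI - eta) PI) <= (PI - (PI - eta)) * 108).
  { apply (Cmod_CInt_le g (PI - eta) PI _ _ ltac:(lra)) with (2 := Hg (PI - eta) PI ltac:(lra) ltac:(lra) ltac:(lra)).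
    intros v Hv; unfold g; destruct (Req_dec v PI) as [->|n].
    - unfold extended_integrand; destruct Rlt_dec; [|rewrite Cmod_0; lra].
      destruct Rlt_dec; [lra|rewrite Cmod_0; lra].
    - rewrite extended_integrand_eq by lra.
      eapply Rle_trans; [apply (integrand_near_PI z v Hz); [lra|]|lra].
      eapply Rle_trans; [|exact HeK]; apply Rmult_le_compat_r; lra. }
  lra.
Qed.

Lemma truncated_integral_limit (w : C) :
  slit_plane 0 (lambert w) -> principal_region w ->
  exists K eta0, 0 <= K /\ 0 < eta0 /\ forall eta, 0 < eta < eta0 ->
  Cmod (CInt (LambertW_integrand (lambert w)) eta (PI - eta) - RtoC PI / Cexp w) <= K * eta.
Proof.
  intros Hz Hw; assert (HP := PI2_3_2).
  destruct (kernel_integral_near_m1 w Hz Hw) as [M [rho [HM [Hrho HJ]]]].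
  assert (Hw1 := principal_region_Re_gt_m1 w Hz Hw); assert (Hz0 := Cmod_ge_0 (lambert w)).
  assert (Habs := Rle_abs (Re w)); assert (Habs0 := Rabs_pos (Re w)).
  assert (Him : Rabs (Im w) < PI) by (apply Rabs_def1; destruct Hw; lra).
  set (B := Cmod (lambert w) + 5 + Rabs (Re w)).
  assert (HB : 0 < / B) by (apply Rinv_0_lt_compat; unfold B; lra).
  exists (M + 16), (Rmin 1 (Rmin rho (Rmin (1 + Re w) (Rmin (/ B) (PI - Rabs (Im w)))))).
  split; [lra|split].
  { repeat apply Rmin_case; lra. }
  intros eta [He0 He].
  apply lt_Rmin in He; destruct He as [He1 He].
  apply lt_Rmin in He; destruct He as [He2 He].
  apply lt_Rmin in He; destruct He as [He3 He].
  apply lt_Rmin in He; destruct He as [He4 He5].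
  assert (Hcot := one_minus_v_cot_bounds eta ltac:(lra)).
  set (V := PI - eta).
  assert (HV : 2 * (PI / 3) <= V < PI) by (unfold V; lra).
  assert (HX := cot_near_PI V HV).
  replace (PI - V) with eta in HX by (unfold V; ring).
  assert (HBe : B < / eta).
  { rewrite <- (Rinv_inv B); apply Rinv_lt_contravar; [|exact He4].
    apply Rmult_lt_0_compat; assumption. }
  assert (HT := truncated_integral w eta V Hz Hw He0 ltac:(unfold V; lra) (proj2 HV)
    ltac:(lra) ltac:(unfold B in *; lra) ltac:(unfold V; lra)).
  cbv beta zeta in HT.
  assert (H1 := HJ eta (conj He0 He2)).
  assert (H2 := kernel_integral_far_right w V Hz Hw HV ltac:(unfold B in *; lra)
    ltac:(unfold B in *; lra)).
  replace (PI - V) with eta in H2 by (unfold V; ring).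
  set (D := (CInt _ eta V - _)%C) in *.
  set (J1 := kernel_integral _ _ _ (- eta) eta) in *.
  set (J2 := kernel_integral _ _ _ (- V) V) in *.
  assert (HD : 2 * Cmod D = Cmod (J1 - J2)).
  { rewrite <- HT, !Cmod_mult, Cmod_Ci, Cmod_R, Rabs_right by lra; ring. }
  assert (H3 : Cmod (J1 - J2) <= Cmod J1 + Cmod J2).
  { rewrite <- (Cmod_opp J2); apply Cmod_triangle. }
  assert (H4 := Cmod_ge_0 D); lra.
Qed.

Lemma Ceq_of_small_distance (c d : C) (K eta0 : R) : 0 <= K -> 0 < eta0 ->
  (forall eta, 0 < eta < eta0 -> Cmod (c - d) <= K * eta) -> c = d.
Proof.
  intros HK H0 H.
  assert (E : (c - d)%C = RtoC 0).
  { apply Cmod_eq_0; apply Rle_antisym; [|apply Cmod_ge_0].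
    apply Rnot_lt_le; intros Hp.
    set (eta := Rmin (eta0 / 2) (Cmod (c - d) / (2 * (K + 1)))).
    assert (Hq : 0 < Cmod (c - d) / (2 * (K + 1))) by (apply Rdiv_lt_0_compat; lra).
    assert (He : 0 < eta) by (unfold eta; apply Rmin_case; lra).
    assert (He1 : eta <= eta0 / 2) by apply Rmin_l.
    assert (He2 : eta <= Cmod (c - d) / (2 * (K + 1))) by apply Rmin_r.
    specialize (H eta ltac:(lra)).
    apply (Rmult_le_compat_l (2 * (K + 1))) in He2; [|lra].
    replace (2 * (K + 1) * (Cmod (c - d) / (2 * (K + 1)))) with (Cmod (c - d)) in He2 by (field; lra).
    nra. }
  replace c with (c - d + d)%C by ring; rewrite E; ring.
Qed.

Lemma LambertW_integral (w : C) : slit_plane 0 (lambert w) -> principal_region w ->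
  CInt (LambertW_integrand (lambert w)) 0 PI = (RtoC PI / Cexp w)%C.
Proof.
  intros Hz Hw.
  destruct (integral_end_pieces _ Hz) as [K1 [e1 [HK1 [He1 H1]]]].
  destruct (truncated_integral_limit w Hz Hw) as [K2 [e2 [HK2 [He2 H2]]]].
  apply (Ceq_of_small_distance _ _ (K1 + K2) (Rmin e1 e2)); [lra|apply Rmin_case; lra|].
  intros eta [He0 He]; apply lt_Rmin in He.
  specialize (H1 eta ltac:(lra)); specialize (H2 eta ltac:(lra)).
  set (I := CInt _ 0 PI) in *; set (I' := CInt _ eta _) in *; set (L := (RtoC PI / Cexp w)%C) in *.
  replace (I - L)%C with ((I - I') + (I' - L))%C by ring.
  eapply Rle_trans; [apply Cmod_triangle|lra].
Qed.

Theorem theorem3p1 (W : C -> C) (HW : is_principal_LambertW W)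
    (z : C) (hz0 : z <> RtoC 0) (hz : slit_plane 0 z) :
  ex_RInt (V := C_R_NormedModule) (LambertW_integrand z) 0 PI /\
  (W z / z =
   RtoC (1 / PI)%R *
     RInt (V := C_R_CompleteNormedModule) (LambertW_integrand z) 0 PI)%C.
Proof.
  destruct (LambertW_in_region W z HW hz) as [Hl Hr].
  split; [now apply ex_CInt_integrand|].
  assert (HI : CInt (LambertW_integrand z) 0 PI = (RtoC PI / Cexp (W z))%C).
  { rewrite <- Hl in hz |- * at 1; rewrite LambertW_integral; try assumption; reflexivity. }
  rewrite HI.
  assert (HP : RtoC PI <> RtoC 0) by (intros E; apply RtoC_inj in E; exact (PI_neq0 E)).
  assert (He := Cexp_neq_0 (W z)).
  assert (Hw : W z <> RtoC 0).
  { intros E; apply hz0; rewrite <- Hl; unfold lambert; rewrite E; ring. }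
  rewrite RtoC_div by exact PI_neq0.
  rewrite <- Hl at 2; unfold lambert; field; repeat split; assumption.
Qed.
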